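(* Let $M$ be a graphic matroid. The element splitting matroid $M'_{x,y}$ is cographic for every pair $\{x,y\}$ of (distinct) elements of $M$ if and only if $M$ has no minor isomorphic to $M(K_4)$, where $K_4$ is the complete graph on $4$ vertices.
   Context: All matroids are finite. $M(G)$ denotes the cycle matroid of a graph $G$. A matroid is graphic if it is isomorphic to $M(G)$ for some graph $G$, and cographic if its dual is graphic. Element splitting: let $M$ be a binary matroid on $E$, represented by a matrix $A$ over $GF(2)$ (columns indexed by $E$), let $x,y\in E$ be distinct and $a\notin E$. Let $A'_{x,y}$ be the matrix obtained from $A$ by adjoining an extra row which is $1$ in the columns of $x$ and $y$ and $0$ in all other columns, and then adjoining an extra column, labelled $a$, which is $1$ in the new row and $0$ in all other rows. The element splitting matroid $M'_{x,y}$ is the vector matroid over $GF(2)$ of $A'_{x,y}$, on the ground set $E\cup\{a\}$ (it does not depend on the choice of the representation $A$ of $M$). *)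

(* Defs.v *)
From HB Require Import structures.
From mathcomp Require Import all_boot all_order all_algebra.

Set Implicit Arguments.
Unset Strict Implicit.
Unset Printing Implicit Defensive.

Import GRing.Theory.

(* A matroid whose ground set is the whole finite type T. *)
Record matroid (T : finType) := Matroid {
  indep : {set {set T}};
  indep_set0 : set0 \in indep;
  indep_sub : forall I J : {set T},
    J \in indep -> I \subset J -> I \in indep;
  indep_aug : forall I J : {set T},
    I \in indep -> J \in indep -> #|I| < #|J| ->
    exists2 e, e \in J :\: I & e |: I \in indep
}.

Definition matroid_iso (T U : finType) (M : matroid T) (N : matroid U) : Prop :=
  exists2 f : T -> U, bijective f &
    forall X : {set T}, (f @: X \in indep N) = (X \in indep M).

Definition basis (T : finType) (M : matroid T) (B : {set T}) : bool :=
  maxset (fun X => X \in indep M) B.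

Lemma basis_indep (T : finType) (M : matroid T) B : basis M B -> B \in indep M.
Proof. exact: maxsetp. Qed.

Lemma basis_ext (T : finType) (M : matroid T) (I : {set T}) :
  I \in indep M -> exists2 B, basis M B & I \subset B.
Proof.
by move=> HI; have [B hB sIB] := @maxset_exists _ (fun X => X \in indep M) I HI;
   exists B.
Qed.

Lemma indep_card_basis (T : finType) (M : matroid T) (I B : {set T}) :
  I \in indep M -> basis M B -> #|I| <= #|B|.
Proof.
move=> HI hB; rewrite leqNgt; apply/negP=> ltBI.
have [e /setDP[_ eB] HeB] := indep_aug (basis_indep hB) HI ltBI.
have /maxsetP[_ /(_ _ HeB (subsetUr _ _)) E] := hB.
by move: eB; rewrite -E !inE eqxx.
Qed.

Lemma indep_ext_basis (T : finType) (M : matroid T) (I B : {set T}) :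
  I \in indep M -> basis M B ->
  exists B', [/\ basis M B', I \subset B' & B' \subset I :|: B].
Proof.
move=> HI hB.
have [|B' /maxsetP[/andP[HB' sB'] maxB'] sIB'] :=
  @maxset_exists _ (fun X => (X \in indep M) && (X \subset I :|: B)) I.
  by rewrite HI subsetUl.
exists B'; split=> //.
have leBB' : #|B| <= #|B'|.
  rewrite leqNgt; apply/negP=> lt.
  have [e /setDP[eB eB'] HeB'] := indep_aug HB' (basis_indep hB) lt.
  have E : e |: B' = B'.
    apply: maxB'; last exact: subsetUr.
    by rewrite HeB' subUset sB' sub1set inE eB orbT.
  by move: eB'; rewrite -E !inE eqxx.
apply/maxsetP; split=> // Y HY sY; apply/esym/eqP.
by rewrite eqEcard sY (leq_trans (indep_card_basis HY hB)).
Qed.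

Section Dual.
Variables (T : finType) (M : matroid T).

Definition dual_indep : {set {set T}} :=
  [set I : {set T} | [exists B : {set T}, basis M B && [disjoint I & B]]].

Lemma dual_indep0 : set0 \in dual_indep.
Proof.
have [B hB _] := basis_ext (indep_set0 M).
by rewrite inE; apply/existsP; exists B; rewrite hB -setI_eq0 set0I /=.
Qed.

Lemma dual_indep_sub (I J : {set T}) :
  J \in dual_indep -> I \subset J -> I \in dual_indep.
Proof.
rewrite !inE => /existsP[B /andP[hB dJB]] sIJ; apply/existsP; exists B.
by rewrite hB (disjointWl sIJ).
Qed.

Lemma dual_indep_aug (I J : {set T}) :
  I \in dual_indep -> J \in dual_indep -> #|I| < #|J| ->
  exists2 e, e \in J :\: I & e |: I \in dual_indep.
Proof.
rewrite !inE => /existsP[B1 /andP[hB1 dI1]] /existsP[B2 /andP[hB2 dJ2]] ltIJ.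
have HD : B2 :\: I \in indep M.
  by apply: indep_sub (basis_indep hB2) _; exact: subsetDl.
have [B [hB sDB sB]] := indep_ext_basis HD hB1.
have dIB : [disjoint I & B].
  apply/pred0P=> x /=; apply/negP=> /andP[xI /(subsetP sB)].
  by rewrite !inE xI /= (disjointFr dI1).
have [sJB|] := boolP (J :\: I \subset B).
  have dd : [disjoint B2 :\: I & J :\: I].
    apply: disjointWl (subsetDl _ _) _; apply: disjointWr (subsetDl _ _) _.
    by rewrite disjoint_sym.
  have : #|B2 :\: I| + #|J :\: I| <= #|B|.
    have -> : #|B2 :\: I| + #|J :\: I| = #|(B2 :\: I) :|: (J :\: I)|.
      by rewrite cardsU disjoint_setI0 // cards0 subn0.
    by apply: subset_leq_card; rewrite subUset sDB.
  have e2 := cardsID I B2; have eJ := cardsID I J; have eI := cardsID J I.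
  have le1 : #|B2 :&: I| <= #|I :\: J|.
    apply: subset_leq_card; apply/subsetP=> x /setIP[xB xI].
    rewrite inE xI andbT; apply/negP=> xJ.
    by move/disjointFr: dJ2 => /(_ _ xJ); rewrite xB.
  have leBB2 := indep_card_basis (basis_indep hB) hB2.
  rewrite (setIC J I) in eJ.
  rewrite leqNgt => /negP[]; apply: leq_ltn_trans leBB2 _.
  rewrite -e2 addnC ltn_add2l; apply: leq_ltn_trans le1 _.
  by rewrite -(ltn_add2l #|I :&: J|) eI eJ.
case/subsetPn=> e eJI eB; exists e => //.
rewrite inE; apply/existsP; exists B; rewrite hB /=.
by apply/pred0P=> x /=; rewrite !inE; case: eqP => [->|_] /=;
  [rewrite (negbTE eB) | have /pred0P/(_ x) := dIB].
Qed.

Definition dual : matroid T :=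
  Matroid dual_indep0 dual_indep_sub dual_indep_aug.
End Dual.

Section Delete.
Variables (T : finType) (M : matroid T) (D : {set T}).
Let S := {x : T | x \notin D}.

Definition delete_indep : {set {set S}} :=
  [set I : {set S} | val @: I \in indep M].

Lemma delete_indep0 : set0 \in delete_indep.
Proof. by rewrite inE imset0 indep_set0. Qed.

Lemma delete_indep_sub (I J : {set S}) :
  J \in delete_indep -> I \subset J -> I \in delete_indep.
Proof. by rewrite !inE => HJ sIJ; apply: indep_sub HJ _; exact: imsetS. Qed.

Lemma delete_indep_aug (I J : {set S}) :
  I \in delete_indep -> J \in delete_indep -> #|I| < #|J| ->
  exists2 e, e \in J :\: I & e |: I \in delete_indep.
Proof.
rewrite !inE => HI HJ ltIJ.
have [|x] := indep_aug HI HJ; first by rewrite !card_imset //; exact: val_inj.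
case/setDP=> /imsetP[e eJ ->] eI He; exists e.
  by rewrite inE eJ andbT; apply: contra eI => ?; exact: imset_f.
by rewrite inE imsetU1.
Qed.

Definition delete : matroid S :=
  Matroid delete_indep0 delete_indep_sub delete_indep_aug.
End Delete.

(* M / C = (M* \ C)* *)
Definition contract (T : finType) (M : matroid T) (C : {set T}) :
  matroid {x : T | x \notin C} := dual (delete (dual M) C).

Definition has_minor (T U : finType) (M : matroid T) (N : matroid U) : Prop :=
  exists (C : {set T}) (D : {set {x : T | x \notin C}}),
    matroid_iso (delete (contract M C) D) N.

Local Open Scope ring_scope.

(* A matrix with columns indexed by T is the family A of its columns;
   [free] is a property of sequences, so that repeated columns are dependent. *)
Section VectorMatroid.
Variables (F : fieldType) (r : nat) (T : finType) (A : T -> 'cV[F]_r).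

Definition vector_indep : {set {set T}} :=
  [set X : {set T} | free [seq A e | e <- enum X]].

Lemma vector_indep0 : set0 \in vector_indep.
Proof. by rewrite inE enum_set0 nil_free. Qed.

Lemma vector_indep_sub (I J : {set T}) :
  J \in vector_indep -> I \subset J -> I \in vector_indep.
Proof.
rewrite !inE => HJ sIJ.
have : perm_eq (enum J) (enum I ++ enum (J :\: I)).
  apply: uniq_perm; rewrite ?enum_uniq // ?cat_uniq ?enum_uniq /= ?andbT.
    by apply/hasPn=> x; rewrite !mem_enum => /setDP[].
  move=> x; rewrite mem_cat !mem_enum inE.
  by case: (boolP (x \in I)) => //= /(subsetP sIJ).
move/(perm_map A); rewrite map_cat => /perm_free E.
by move: HJ; rewrite E => /catl_free.
Qed.

Lemma vector_indep_aug (I J : {set T}) :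
  I \in vector_indep -> J \in vector_indep -> (#|I| < #|J|)%N ->
  exists2 e, e \in J :\: I & e |: I \in vector_indep.
Proof.
rewrite !inE => HI HJ ltIJ.
have [/existsP[e /andP[eJ eI]]|] :=
  boolP [exists e, (e \in J) && (A e \notin <<[seq A e | e <- enum I]>>%VS)].
  have eI' : e \notin I.
    by apply: contra eI => eI; apply/memv_span/map_f; rewrite mem_enum.
  exists e; first by rewrite inE eI'.
  have : perm_eq (enum (e |: I)) (e :: enum I).
    apply: uniq_perm; rewrite /= ?enum_uniq ?mem_enum ?eI' //.
    by move=> x; rewrite !inE !mem_enum !inE.
  by move/(perm_map A)/perm_free; rewrite inE => ->; rewrite free_cons eI.
rewrite negb_exists => /forallP H; move: ltIJ.
have sJI : (<<[seq A e | e <- enum J]>> <= <<[seq A e | e <- enum I]>>)%VS.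
  apply/span_subvP=> v /mapP[e]; rewrite mem_enum => eJ ->.
  by move: (H e); rewrite eJ negbK.
move/dimvS: sJI; move: HI HJ; rewrite /free !size_map -!cardE => /eqP-> /eqP->.
by rewrite leqNgt => /negbTE->.
Qed.

Definition vector_matroid : matroid T :=
  Matroid vector_indep0 vector_indep_sub vector_indep_aug.

Lemma vector_indepP (X : {set T}) :
  reflect (forall k : T -> F, \sum_(e in X) k e *: A e = 0 ->
             {in X, forall e, k e = 0})
          (X \in vector_indep).
Proof.
have sz : size [seq A e | e <- enum X] == #|X| by rewrite size_map -cardE.
have nE (i : 'I_#|X|) : [seq A e | e <- enum X]`_i = A (enum_val i).
  have i_lt : (i < size (enum X))%N by rewrite -cardE.
  by rewrite (nth_map (enum_default i) 0 A).
rewrite inE; apply: (iffP (@freeP _ _ _ (Tuple sz))) => H k sk.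
  move=> e eX; have := H (fun i => k (enum_val i)) _ (enum_rank_in eX e).
  rewrite enum_rankK_in //; apply; rewrite -[RHS]sk [RHS]big_enum_val.
  by apply: eq_bigr => i _; rewrite nE.
move=> i; pose k' e := k (enum_rank_in (enum_valP i) e).
have := H k' _ (enum_val i) (enum_valP i).
rewrite /k' enum_valK_in; apply; rewrite -[RHS]sk [LHS]big_enum_val.
by apply: eq_bigr => j _; rewrite nE enum_valK_in.
Qed.
End VectorMatroid.

Section GF2.
Variables (r : nat) (T : finType) (A : T -> 'cV['F_2]_r).

Lemma F2E (k : 'F_2) : k = (k != 0)%:R.
Proof. by case: k => [[|[|//]] ?]; apply/val_inj. Qed.

Lemma vector_indep_F2P (X : {set T}) :
  reflect (forall S : {set T}, S \subset X -> \sum_(e in S) A e = 0 -> S = set0)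
          (X \in vector_indep A).
Proof.
apply: (iffP (vector_indepP A X)) => H.
  move=> S sSX S0; apply/eqP; rewrite -subset0; apply/subsetP=> e eS.
  have sum0 : \sum_(f in X) (f \in S)%:R *: A f = 0.
    rewrite -[RHS]S0 [LHS](big_setID S) /= (setIidPr sSX).
    rewrite [X in _ + X]big1 ?addr0.
      by apply: eq_bigr => f ->; rewrite scale1r.
    by move=> f /setDP[_ /negbTE->]; rewrite scale0r.
  have /eqP := H (fun f => (f \in S)%:R) sum0 e (subsetP sSX _ eS).
  by rewrite eS oner_eq0.
move=> k sk; have := H [set e in X | k e != 0].
move=> /(_ _ _)H'; have {H'} E : [set e in X | k e != 0] = set0.
  apply: H'; first by apply/subsetP=> e; rewrite inE => /andP[].
  rewrite -[RHS]sk [RHS](bigID (fun e => k e != 0)) /= [X in _ = _ + X]big1 ?addr0.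
    rewrite (eq_bigl (fun e => (e \in X) && (k e != 0))) => [|e]; last by rewrite inE.
    by apply: eq_bigr => e /andP[_ ke]; rewrite (F2E (k e)) ke scale1r.
  by move=> e /andP[_]; rewrite negbK => /eqP->; rewrite scale0r.
move=> e eX; apply/eqP; move/setP/(_ e): E.
by rewrite !inE eX /= => /negbFE.
Qed.
End GF2.

Lemma addvv_F2 r (v : 'cV['F_2]_r) : v + v = 0.
Proof. by apply/colP=> i; rewrite !mxE; case: (v i 0) => [[|[|//]] ?]; apply/val_inj. Qed.

(* Finite multigraphs; loops and parallel edges are allowed. *)
Record graph := Graph {
  vertex : finType;
  edge : finType;
  ends : edge -> vertex * vertex
}.

Definition joins (G : graph) (e : edge G) (u v : vertex G) : bool :=
  (ends e == (u, v)) || (ends e == (v, u)).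

(* The closed walk v_0 e_0 v_1 e_1 ... v_(k-1) e_(k-1) v_0 is encoded as
   [:: (v_0, e_0); ...; (v_(k-1), e_(k-1))]. *)
Definition is_cycle (G : graph) (s : seq (vertex G * edge G)) : bool :=
  [&& s != [::], uniq (unzip1 s), uniq (unzip2 s)
    & cycle (fun p q => joins p.2 p.1 q.1) s].

(* The bound on the length is harmless: see [acyclicP]. *)
Definition acyclic (G : graph) (X : {set edge G}) : bool :=
  [forall k : 'I_#|vertex G|.+1, forall s : k.-tuple (vertex G * edge G),
     is_cycle s ==> ~~ all [in X] (unzip2 s)].

Lemma acyclicP (G : graph) (X : {set edge G}) :
  reflect (forall s, is_cycle s -> ~ {subset unzip2 s <= X}) (acyclic X).
Proof.
apply: (iffP forallP) => [H s Hs sX|H k]; last first.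
  by apply/forallP=> s; apply/implyP=> /H nsX; apply/negP=> /allP.
have sz : (size s < #|vertex G|.+1)%N.
  case/and4P: (Hs) => _ us _ _.
  rewrite ltnS -(size_map fst); apply: leq_trans (max_card [in unzip1 s]).
  by rewrite (card_uniqP us).
have /forallP/(_ (in_tuple s))/implyP/(_ Hs)/negP[] := H (Ordinal sz).
exact/allP.
Qed.

Section Incidence.
Variable G : graph.
Local Notation V := (vertex G).
Local Notation E := (edge G).

Definition unit_col (v : V) : 'cV['F_2]_#|V| :=
  \col_i (enum_val i == v)%:R.

(* The mod 2 incidence matrix, in which loops give zero columns. *)
Definition incidence (e : E) : 'cV['F_2]_#|V| :=
  unit_col (ends e).1 + unit_col (ends e).2.

Lemma incidence_joins e u v : joins e u v -> incidence e = unit_col u + unit_col v.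
Proof.
by rewrite /incidence => /orP[] /eqP->; rewrite //= addrC.
Qed.

Lemma walk_sum p s : path (fun p q : V * E => joins p.2 p.1 q.1) p s ->
  \sum_(q <- belast p s) incidence q.2 = unit_col p.1 + unit_col (last p s).1.
Proof.
elim: s p => [|q s IHs] p /=; first by rewrite big_nil addvv_F2.
case/andP=> /incidence_joins pq /IHs; rewrite big_cons pq => ->.
by rewrite addrA -(addrA (unit_col p.1)) addvv_F2 addr0.
Qed.

Lemma cycle_sum s : is_cycle s -> \sum_(e <- unzip2 s) incidence e = 0.
Proof.
case/and4P=> s0 _ _; case: s s0 => // p s _ /walk_sum.
by rewrite belast_rcons last_rcons addvv_F2 => sum0; rewrite big_map sum0.
Qed.

Lemma simple_path_edges (X : {set E}) u p :
  path (fun a b => [exists e in X, joins e a b]) u p -> uniq (u :: p) ->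
  exists s : seq (V * E),
    [/\ unzip1 s = belast u p, uniq (unzip2 s), {subset unzip2 s <= X},
        (forall e w, e \in unzip2 s -> w \in [:: (ends e).1; (ends e).2] ->
            w \in u :: p)
      & forall e0, path (fun p q : V * E => joins p.2 p.1 q.1)
          (head (last u p, e0) s) (behead (rcons s (last u p, e0)))].
Proof.
elim: p u => [|v p IHp] u /=; first by exists [::].
case/andP=> /exists_inP[e eX euv] pp /andP[up uvp].
have [s [s1 s2 sX sV sp]] := IHp v pp uvp.
exists ((u, e) :: s); split=> /=.
- by rewrite s1.
- rewrite s2 andbT; apply/negP=> es; case/negP: up.
  apply: sV es _; case/orP: euv => /eqP->; rewrite !inE eqxx ?orbT //.
- by move=> f; rewrite inE => /predU1P[->|/sX].
- move=> f w; rewrite inE => /predU1P[->|fs] Hw; last first.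
    by rewrite inE (sV f w fs Hw) orbT.
  move: Hw; case/orP: euv => /eqP-> /=; rewrite !inE;
    by case/orP=> /eqP->; rewrite eqxx ?orbT.
move=> e0; have := sp e0; case: s s1 {s2 sX sV sp} => [|q s] /=.
  by case: p {IHp pp up uvp} => //= _ _; rewrite euv.
by case: p {IHp pp up uvp} => //= a p [-> _]; rewrite euv.
Qed.

Lemma acyclic_vector_indep (X : {set E}) :
  acyclic X = (X \in vector_indep incidence).
Proof.
apply/acyclicP/vector_indep_F2P => H; last first.
  move=> s Hs sX; case/and4P: (Hs) => s0 _ us _.
  have : [set e in unzip2 s] = set0.
    apply: H; first by apply/subsetP=> e; rewrite inE => /sX.
    rewrite -[RHS](cycle_sum Hs) [RHS]big_uniq //=.
    by apply: eq_bigl => e; rewrite inE.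
  by case: s s0 {Hs sX us} => // p s _ /setP/(_ p.2); rewrite !inE eqxx.
move=> S sSX S0; apply/eqP; apply/set0Pn=> -[e eS].
pose r := [rel a b | [exists f in S :\ e, joins f a b]].
pose u := (ends e).1; pose v := (ends e).2.
have uv : connect r u v.
  apply/negPn/negP=> nuv.
  pose K := [set w | connect r u w].
  pose g (x : 'cV['F_2]_#|V|) := \sum_(w in K) x (enum_rank w) 0.
  have gD x y : g (x + y) = g x + g y.
    by rewrite -big_split; apply: eq_bigr => w _; rewrite mxE.
  have g0 : g 0 = 0 by rewrite /g big1 // => w _; rewrite mxE.
  have gu w : g (unit_col w) = (w \in K)%:R.
    rewrite /g; have [wK|wK] := boolP (w \in K).
      rewrite (bigD1 w) //= mxE enum_rankK eqxx big1 ?addr0 // => z /andP[_ zw].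
      by rewrite mxE enum_rankK (negbTE zw).
    rewrite big1 // => z zK; rewrite mxE enum_rankK.
    by case: eqP wK => // <-; rewrite zK.
  have ge : g (incidence e) = 1.
    by rewrite gD !gu !inE connect0 (negbTE nuv) addr0.
  have gf f : f \in S :\ e -> g (incidence f) = 0.
    move=> fS; rewrite gD !gu !inE.
    have sym a b : joins f a b -> connect r u a -> connect r u b.
      move=> fab ua; apply: connect_trans ua (connect1 _).
      by apply/exists_inP; exists f.
    have -> : connect r u (ends f).1 = connect r u (ends f).2.
      by apply/idP/idP; apply: sym; rewrite /joins -surjective_pairing eqxx ?orbT.
    by case: (connect _ _ _); apply/val_inj.
  have : g (\sum_(f in S) incidence f) = 1.
    rewrite (big_morph g gD g0) (bigD1 e) //= ge big1 ?addr0 // => f /andP[fS fe].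
    by apply: gf; rewrite !inE fe.
  by rewrite S0 g0 => /eqP; rewrite eq_sym oner_eq0.
have eE : ends e = (u, v) by rewrite /u /v -surjective_pairing.
case/connectP: uv => p0 /shortenP[p pp up _ {p0} lp].
have [s [s1 s2 sX _ sp]] := simple_path_edges pp up.
have {}sp := sp e; rewrite -lp in sp.
have es : e \notin unzip2 s by apply/negP=> /sX; rewrite !inE eqxx.
apply: (H (rcons s (v, e))); last first.
  move=> f; rewrite /unzip2 map_rcons mem_rcons inE => /predU1P[->|/sX].
    exact: (subsetP sSX).
  by rewrite inE => /andP[_ /(subsetP sSX)].
apply/and4P; split.
- by rewrite -size_eq0 size_rcons.
- by rewrite /unzip1 map_rcons -/unzip1 -/(unzip1 s) s1 lp -lastI.
- by rewrite /unzip2 map_rcons rcons_uniq es s2.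
case: s s1 sp {s2 sX es} => [|q s] /= s1 sp.
  case: p s1 lp {pp up sp} => //= _ lp.
  by rewrite andbT /joins eE lp eqxx.
rewrite rcons_path sp /= last_rcons /=.
by case: p s1 {pp up lp sp} => //= a p [-> _]; rewrite /joins eE eqxx orbT.
Qed.
End Incidence.

Section CycleMatroid.
Variable G : graph.

Definition cycle_indep : {set {set edge G}} := [set X | acyclic X].

Lemma cycle_indepE : cycle_indep = vector_indep (@incidence G).
Proof. by apply/setP=> X; rewrite inE acyclic_vector_indep. Qed.

Lemma cycle_indep0 : set0 \in cycle_indep.
Proof. by rewrite cycle_indepE vector_indep0. Qed.

Lemma cycle_indep_sub (I J : {set edge G}) :
  J \in cycle_indep -> I \subset J -> I \in cycle_indep.
Proof. by rewrite cycle_indepE; exact: vector_indep_sub. Qed.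

Lemma cycle_indep_aug (I J : {set edge G}) :
  I \in cycle_indep -> J \in cycle_indep -> (#|I| < #|J|)%N ->
  exists2 e, e \in J :\: I & e |: I \in cycle_indep.
Proof. by rewrite cycle_indepE; exact: vector_indep_aug. Qed.

Definition cycle_matroid : matroid (edge G) :=
  Matroid cycle_indep0 cycle_indep_sub cycle_indep_aug.
End CycleMatroid.

Definition graphic (T : finType) (M : matroid T) : Prop :=
  exists G : graph, matroid_iso M (cycle_matroid G).

Definition cographic (T : finType) (M : matroid T) : Prop := graphic (dual M).

Definition complete_graph (n : nat) : graph :=
  @Graph 'I_n {p : 'I_n * 'I_n | (p.1 < p.2)%N} val.

(* A matrix over GF(2) with columns indexed by T, and any number of rows. *)
Definition gf2_matrix (T : finType) := {r : nat & {ffun T -> 'cV['F_2]_r}}.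

Definition represents (T : finType) (A : gf2_matrix T) (M : matroid T) : bool :=
  indep (vector_matroid (tagged A)) == indep M.

Definition binary (T : finType) (M : matroid T) : Prop :=
  exists A : gf2_matrix T, represents A M.

Lemma graphic_binary (T : finType) (M : matroid T) : graphic M -> binary M.
Proof.
case=> G [f bf Hf].
exists (Tagged (fun r => {ffun T -> 'cV['F_2]_r}) [ffun e => incidence (f e)]).
apply/eqP/setP=> X; rewrite -Hf /= cycle_indepE !inE; apply: perm_free.
rewrite (eq_map (ffunE _)) (map_comp (@incidence G) f); apply: perm_map.
apply: uniq_perm; rewrite ?enum_uniq ?(map_inj_uniq (bij_inj bf)) ?enum_uniq //.
move=> y; rewrite mem_enum; apply/mapP/imsetP=> -[x xX ->]; exists x => //.
  by rewrite -mem_enum.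
by rewrite mem_enum.
Qed.

(* The column family of A'_{x,y}; the new element a is None. *)
Definition split_matrix (T : finType) (r : nat) (A : T -> 'cV['F_2]_r) (x y : T)
    (e : option T) : 'cV['F_2]_(r + 1) :=
  match e with
  | Some e => col_mx (A e) (const_mx (e \in [set x; y])%:R)
  | None => col_mx 0 (const_mx 1)
  end.

(* M'_{x,y}, computed from an arbitrarily chosen representation of M; by
   [elem_splitE] the choice does not matter. *)
Definition elem_split (T : finType) (M : matroid T) (hM : binary M) (x y : T) :
    matroid (option T) :=
  vector_matroid (split_matrix (tagged (xchoose hM)) x y).

Section SplitIndep.
Variables (T : finType) (x y : T).

Definition zero_sum (U : finType) r (A : U -> 'cV['F_2]_r) (S : {set U}) :=
  \sum_(e in S) A e == 0.

Lemma zero_sum_vector_indep (U : finType) r1 r2 (A : U -> 'cV['F_2]_r1)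
    (B : U -> 'cV['F_2]_r2) :
  vector_indep A = vector_indep B <-> forall S, zero_sum A S = zero_sum B S.
Proof.
split=> [AB S|AB]; last first.
  apply/setP=> X; apply/vector_indep_F2P/vector_indep_F2P=> H S sSX /eqP S0;
    by apply: H sSX _; apply/eqP; move: S0; rewrite -!/(zero_sum _ _) AB.
wlog suff main : r1 r2 A B AB S / zero_sum A S -> zero_sum B S.
  by apply/idP/idP; apply: main.
have [n] := ubnP #|S|; elim: n => // n IHn in S *; rewrite ltnS => leSn SA.
have [->|S0] := eqVneq S set0; first by rewrite /zero_sum big_set0.
pose P (C : {set U}) := C \notin vector_indep B.
have PS : P S.
  rewrite /P -AB; apply/vector_indep_F2P=> /(_ S (subxx _) (eqP SA)).
  by move/eqP; rewrite (negbTE S0).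
have [C /minsetP[PC minC] sCS] := minset_exists PS.
have zC r (D : U -> 'cV['F_2]_r) : vector_indep D = vector_indep B -> zero_sum D C.
  move=> DB; move: (PC); rewrite /P -DB => /vector_indep_F2P H.
  apply/negPn/negP=> nC; apply: H => Z sZC Z0; apply/eqP/negPn/negP=> nZ.
  have PZ : P Z.
    rewrite /P -DB; apply/vector_indep_F2P=> /(_ Z (subxx _) Z0).
    by move/eqP; rewrite (negbTE nZ).
  by move: nC; rewrite -(minC Z PZ sZC) /zero_sum Z0 eqxx.
have zD r (D : U -> 'cV['F_2]_r) : vector_indep D = vector_indep B ->
    zero_sum D S = zero_sum D (S :\: C).
  move=> DB; rewrite /zero_sum (big_setID C) /= (setIidPr sCS).
  by rewrite (eqP (zC _ _ DB)) add0r.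
rewrite zD //; apply: IHn; last by rewrite -zD.
apply: leq_trans leSn; apply: proper_card; rewrite properE subsetDl /=.
have [e eC] : exists e, e \in C.
  apply/set0Pn; apply: contraNneq PC => ->; exact: vector_indep0.
by apply/subsetPn; exists e; rewrite ?(subsetP sCS) // !inE eC.
Qed.

Lemma zero_sum_split r (A : T -> 'cV['F_2]_r) (S : {set option T}) :
  zero_sum (split_matrix A x y) S =
  zero_sum A (Some @^-1: S) &&
  (\sum_(e in S) (if e is Some e then (e \in [set x; y])%:R else 1) == 0 :> 'F_2).
Proof.
rewrite /zero_sum; set a := \sum_(e in _ @^-1: _) _; set b := \sum_(e in S) _.
have -> : \sum_(e in S) split_matrix A x y e = col_mx a (const_mx b).
  apply/colP=> i; rewrite summxE /a /b; case: (splitP i) => j Hj.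
    have -> : i = lshift 1 j by apply: val_inj.
    rewrite col_mxEu summxE.
    rewrite [LHS](bigID (fun e : option T => e == None)) /= big1 ?add0r.
      rewrite (reindex_omap Some id) /= => [|[e|]]; [|by []|by rewrite andbF].
      apply: eq_big => [e|e _]; first by rewrite inE eqxx !andbT.
      by rewrite col_mxEu.
    by move=> e /andP[_ /eqP->] /=; rewrite col_mxEu mxE.
  have -> : i = rshift r j by apply: val_inj.
  rewrite col_mxEd mxE; apply: eq_bigr => -[e|] _ /=; by rewrite col_mxEd mxE.
apply/eqP/andP=> [/eqP|[/eqP-> /eqP->]].
  rewrite -col_mx0 => /eqP/eq_col_mx[-> /colP/(_ 0)].
  by rewrite !mxE => ->.
exact: col_mx0.
Qed.

Lemma split_matrix_indep r1 r2 (A : T -> 'cV['F_2]_r1) (B : T -> 'cV['F_2]_r2) :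
  vector_indep A = vector_indep B ->
  vector_indep (split_matrix A x y) = vector_indep (split_matrix B x y).
Proof.
move=> /zero_sum_vector_indep AB; apply/zero_sum_vector_indep=> S.
by rewrite !zero_sum_split AB.
Qed.
End SplitIndep.

Lemma elem_splitE (T : finType) (M : matroid T) (hM : binary M) (x y : T)
    (A : gf2_matrix T) :
  represents A M ->
  indep (elem_split hM x y) = indep (vector_matroid (split_matrix (tagged A) x y)).
Proof.
move=> /eqP AM; apply: split_matrix_indep.
by have /eqP := xchooseP hM; rewrite -AM.
Qed.

(* Main.v *)
Require Import Defs.
From mathcomp Require Import all_boot.
From mathcomp Require Import all_algebra.
From Stdlib Require Import Classical_Prop.

Set Implicit Arguments.
Unset Strict Implicit.
Unset Printing Implicit Defensive.

(* The dual of M'_{x,y} is M* with a new element a = x + y added. If M is graphic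
   without M(K4) minor, its graph reduces to nothing by deleting loops, pendant
   edges and parallel edges and by contracting an edge at a vertex of degree two,
   since a simple graph of minimum degree three has a K4 minor. Undoing these moves
   in the dual graph, one can always arrange that the duals of x and y share a
   vertex, and then a is the edge closing a triangle with x and y. Conversely,
   splitting M(K4) at two opposite edges gives the dual of F7, and F7 is not graphic
   because in a graph for it the seven edges would be counted twice by vertex stars
   of sizes 0 and 4. *)

(** * Binary matroids given by words *)

Section Codes.
Variable T : finType.
Implicit Types (Z W : (T -> bool) -> Prop) (M : matroid T) (X B : {set T}).

(** Duality is handled through words: the cycle space of a binary matroid is the row space of its
    dual. So the dual of the splitting is graphic exactly when some graph has as its cuts the even
    sets of the graph of [M], each extended by the value z x + z y. A dual graph is not unique, and
    only some of them make the duals of [x] and [y] touch. It is therefore built anew for each pair,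
    using the freedom in where a pendant edge hangs and in which order two edges in series follow
    each other. *)

Record is_code Z : Prop := IsCode {
  code_ext : forall z z', z =1 z' -> Z z -> Z z';
  code0 : Z (fun=> false);
  codeD : forall z z', Z z -> Z z' -> Z (fun e => z e (+) z' e)
}.

(* [coded Z M]: Z is the cycle space of M over GF(2);
   [rowcoded W M]: W is the cocycle (row) space of M. *)
Definition coded Z M : Prop := forall X,
  X \in indep M <->
  forall z, Z z -> (forall e, z e -> e \in X) -> forall e, z e = false.

Definition rowcoded W M : Prop := forall X,
  X \in indep M <->
  forall e, e \in X -> exists2 w, W w & {in X, forall f, w f = (f == e)}.

Lemma coded_notin Z M X : coded Z M -> X \notin indep M ->
  exists z, [/\ Z z, forall e, z e -> e \in X & exists e, z e].
Proof.
move=> ZM /negP XI; apply: NNPP => H; apply: XI; apply/ZM => z Zz zX e.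
by apply/negbTE/negP => ze; apply: H; exists z; split=> //; exists e.
Qed.

(** The word is the fundamental circuit of [e]: avoiding [e], its support would lie in the
    independent set [X]. *)
Lemma coded_notinU Z M X e : coded Z M -> X \in indep M ->
  e |: X \notin indep M ->
  exists z, [/\ Z z, forall f, z f -> f \in e |: X & z e].
Proof.
move=> ZM XI /(coded_notin ZM)[z [Zz zX [f zf]]]; exists z; split=> //.
apply/negPn/negP => /negbTE ze; have /ZM/(_ z Zz) XI' := XI.
rewrite XI' // in zf => g zg; have := zX g zg.
by rewrite !inE => /predU1P[gE|//]; rewrite gE ze in zg.
Qed.

(** Adding [w] corrects, at [e], the words that single out the elements of [B], and leaves them
    unchanged on [B]. *)
Lemma rowcoded_setU1 W M B w e : is_code W -> rowcoded W M -> B \in indep M ->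
  W w -> {in B, forall f, w f = false} -> w e -> e |: B \in indep M.
Proof.
move=> cW WM BI Ww wB we; apply/WM => f.
rewrite !inE => /predU1P[->|fB].
  exists w => // g; rewrite !inE => /predU1P[->|gB]; first by rewrite we eqxx.
  by rewrite wB //; case: eqP gB => // -> /wB; rewrite we.
have [w1 Ww1 w1B] := (WM B).1 BI f fB.
have ef : (e == f) = false.
  by apply/eqP => ef; move: (wB f fB); rewrite -ef we.
have [w1e|w1e] := boolP (w1 e).
  exists (fun g => w1 g (+) w g); first exact: codeD.
  move=> g; rewrite !inE => /predU1P[->|gB]; first by rewrite w1e we ef.
  by rewrite w1B // wB // addbF.
exists w1 => // g; rewrite !inE => /predU1P[->|gB]; last exact: w1B.
by rewrite ef (negbTE w1e).
Qed.

Lemma in_dualP M X :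
  reflect (exists2 B, basis M B & {in X, forall e, e \notin B}) (X \in indep (dual M)).
Proof.
rewrite /= inE; apply: (iffP existsP) => -[B].
  by case/andP=> bB dXB; exists B => // e /(disjointFr dXB) ->.
move=> bB XB; exists B; rewrite bB; apply/pred0P=> e /=.
by apply/negP => /andP[/XB/negP].
Qed.

Lemma basis_setU1 M B e : basis M B -> e |: B \in indep M -> e \in B.
Proof.
by case/maxsetP=> _ H /H <-; rewrite ?subsetUr // !inE eqxx.
Qed.

(** [B] is a basis of the deletion of [X]. Both duality lemmas below show that it is a basis of [M],
    which makes [X] independent in the dual. *)
Lemma max_indep_avoiding M X : exists B, [/\ B \in indep M,
  {in X, forall e, e \notin B} &
  forall e, e \notin X -> e |: B \in indep M -> e \in B].
Proof.
pose P (B : {set T}) := (B \in indep M) && (B \subset ~: X).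
have [|B /maxsetP[/andP[BI BX] maxB] _] := @maxset_exists _ P set0.
  by rewrite /P indep_set0 sub0set.
exists B; split=> // [e eX|e eX eB].
  by apply/negP => /(subsetP BX); rewrite inE eX.
rewrite -(maxB (e |: B)) ?subsetUr ?inE ?eqxx //.
by rewrite /P eB subUset BX sub1set inE eX.
Qed.

Lemma basisI M B : B \in indep M ->
  (forall e, e |: B \in indep M -> e \in B) -> basis M B.
Proof.
move=> BI H; apply/maxsetP; split=> // Y YI BY; apply/eqP.
rewrite eqEsubset BY andbT; apply/subsetP => e eY; apply: H.
by apply: indep_sub YI _; rewrite subUset BY sub1set eY.
Qed.

(** If [X] misses a basis, the fundamental circuits of its elements meet [X] in one element each.
    Conversely, if [e |: B] were independent, reducing the word at [e] modulo fundamental circuits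
    would leave a nonzero word supported in it. *)
Lemma rowcoded_dual Z M : is_code Z -> coded Z M -> rowcoded Z (dual M).
Proof.
move=> cZ ZM X; split.
  move=> /in_dualP[B bB XB] e eX.
  have [|z [Zz zB ze]] := @coded_notinU Z M B e ZM (basis_indep bB).
    by apply: contra (XB e eX); apply: basis_setU1.
  exists z => // f fX; case: eqP => [->//|/eqP fe]; apply/negbTE/negP => /zB.
  by rewrite !inE (negbTE fe) (negbTE (XB f fX)).
move=> H; apply/in_dualP.
have [B [BI BX maxB]] := max_indep_avoiding M X; exists B => //.
apply: basisI => // e eB; have [|eX] := boolP (e \in X); last exact: maxB.
move=> eX; have [z Zz zX] := H e eX; exfalso.
(* Fundamental circuits through elements outside [e |: B] push z into [e |: B]. *)
pose D z := [set f | z f && (f \notin e |: B)].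
have ze : z e by rewrite zX ?eqxx.
have {}zX : forall f, f \in X -> z f -> f = e by move=> f /zX -> /eqP.
have [n] := ubnP #|D z|.
elim: n => // n IHn in z Zz zX ze *; rewrite ltnS => leDn.
have [D0|[f]] := set_0Vmem (D z).
  move: ze; rewrite ((ZM _).1 eB z Zz _ e) // => f zf.
  by have /setP/(_ f) := D0; rewrite !inE zf /= => /negbFE.
rewrite inE => /andP[zf fB].
have fX : f \notin X.
  by apply: contra fB => /zX/(_ zf)->; rewrite !inE eqxx.
have [|z1 [Zz1 z1B z1f]] := @coded_notinU Z M B f ZM BI.
  by apply: contra fB => /(maxB _ fX) fB; rewrite !inE fB orbT.
have z1X g : g \in X -> z1 g = false.
  move=> gX; apply/negbTE/negP => /z1B; rewrite !inE (negbTE (BX g gX)) orbF.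
  by move=> /eqP gf; rewrite gf (negbTE fX) in gX.
apply: (IHn (fun g => z g (+) z1 g)).
- exact: codeD.
- by move=> g gX; rewrite z1X // addbF; apply: zX.
- by rewrite ze z1X.
- apply: leq_trans leDn; apply: proper_card; apply/properP; split.
    apply/subsetP => g; rewrite !inE => /andP[zg gB]; rewrite gB andbT.
    apply: contraLR zg => zg; rewrite (negbTE zg) /=.
    apply/negP => /z1B; rewrite !inE; case: eqP => [gf|_].
      by rewrite gf zf in zg.
    by move: gB; rewrite negb_or => /andP[_ /negbTE->].
  by exists f; rewrite inE zf // z1f.
Qed.

(** A word that vanishes on a basis but not at [e] would allow the basis to be extended by [e], so
    no nonzero word of the row space lives off a basis. *)
Lemma coded_dual W M : is_code W -> rowcoded W M -> coded W (dual M).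
Proof.
move=> cW WM X; split.
  move=> /in_dualP[B bB XB] w Ww wX e; apply/negbTE/negP => we.
  have /negP[] := XB e (wX e we); apply: basis_setU1 (bB) _.
  apply: (rowcoded_setU1 cW WM (basis_indep bB) Ww) => // f fB.
  by apply/negbTE/negP => /wX/XB; rewrite fB.
move=> H; apply/in_dualP.
have [B [BI BX maxB]] := max_indep_avoiding M X; exists B => //.
apply: basisI => // e eB; apply/negPn/negP => enB.
have [|w Ww wB] := (WM (e |: B)).1 eB e; first by rewrite !inE eqxx.
have we : w e by rewrite wB ?eqxx // !inE eqxx.
have {}wB f : f \in B -> w f = false.
  move=> fB; rewrite wB; last by rewrite !inE fB orbT.
  by apply/eqP => fe; rewrite -fe fB in enB.
move: we; rewrite H // => f wf; apply/negPn/negP => fX.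
have fB : f \in B by apply: maxB => //; apply: rowcoded_setU1 WM BI Ww wB wf.
by rewrite wB in wf.
Qed.

(** The minimal dependent sets depend on [M] alone, and each is the support of a word in every code
    of [M]. Adding one that lies inside the support of [z] makes this support smaller. *)
Lemma coded_sub Z1 Z2 M : is_code Z1 -> is_code Z2 -> coded Z1 M -> coded Z2 M ->
  forall z, Z1 z -> Z2 z.
Proof.
move=> c1 c2 Z1M Z2M z; have [n] := ubnP #|[set e | z e]|.
elim: n => // n IHn in z *; rewrite ltnS => lezn Z1z.
have [z0|[e]] := set_0Vmem [set e | z e].
  apply: code_ext (code0 c2) => // e; have /setP/(_ e) := z0.
  by rewrite !inE.
rewrite inE => ze; pose P X := X \notin indep M.
have PS : P [set e | z e].
  apply/negP => /Z1M/(_ z Z1z) zF; rewrite zF // in ze => f.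
  by rewrite inE.
have [C /minsetP[PC minC] sC] := minset_exists PS.
have ZC Z : is_code Z -> coded Z M -> Z (fun e => e \in C).
  move=> cZ ZM; have [z1 [Zz1 z1C [f z1f]]] := coded_notin ZM PC.
  apply: (code_ext cZ _ Zz1) => // g; have {1}<- : [set e | z1 e] = C; last by rewrite inE.
  apply: minC; last by apply/subsetP => h; rewrite inE; apply: z1C.
  apply/negP => /ZM/(_ z1 Zz1) zF; rewrite zF // in z1f => h.
  by rewrite inE.
apply: (code_ext c2 (z := fun e => (z e (+) (e \in C)) (+) (e \in C))).
  by move=> f; rewrite -addbA addbb addbF.
apply: (codeD c2); last exact: ZC.
apply: IHn; last by apply: (codeD c1) => //; apply: ZC.
apply: leq_trans lezn; apply: proper_card; apply/properP; split.
  apply/subsetP => f; rewrite !inE; case: (boolP (f \in C)); last by rewrite addbF.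
  by move/(subsetP sC); rewrite inE => ->.
have [f fC] : exists f, f \in C.
  by apply/set0Pn; apply: contraNneq PC => ->; apply: indep_set0.
by exists f; [apply: (subsetP sC) | move/(subsetP sC): (fC); rewrite !inE fC => ->].
Qed.

Lemma coded_uniq Z1 Z2 M : is_code Z1 -> is_code Z2 -> coded Z1 M -> coded Z2 M ->
  forall z, Z1 z <-> Z2 z.
Proof.
by move=> c1 c2 H1 H2 z; split; [apply: coded_sub H1 H2 z | apply: coded_sub H2 H1 z].
Qed.

Lemma rowcoded_uniq W1 W2 M : is_code W1 -> is_code W2 ->
  rowcoded W1 M -> rowcoded W2 M -> forall w, W1 w <-> W2 w.
Proof.
by move=> c1 c2 /(coded_dual c1) H1 /(coded_dual c2) H2; apply: coded_uniq H1 H2.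
Qed.

Lemma eq_coded Z1 Z2 M : (forall z, Z1 z <-> Z2 z) -> coded Z1 M -> coded Z2 M.
Proof.
move=> E H X; apply: iff_trans (H X) _.
by split=> K z /E; apply: K.
Qed.

Lemma eq_rowcoded W1 W2 M : (forall w, W1 w <-> W2 w) ->
  rowcoded W1 M -> rowcoded W2 M.
Proof.
move=> E H X; apply: iff_trans (H X) _.
by split=> K e /K[w /E]; exists w.
Qed.

End Codes.

(** * Codes of minors *)

Section Minors.
Variable T : finType.
Implicit Types (Z W : (T -> bool) -> Prop) (M : matroid T) (D C : {set T}).

(** Puncturing, followed by shortening, of a code. Deletion shortens the cycle space and punctures
    the row space; contraction does the opposite. *)
Definition restrict_code D Z (z : {x | x \notin D} -> bool) : Prop :=
  exists2 z', Z z' & z =1 z' \o val.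

Definition shorten_code D Z (z : {x | x \notin D} -> bool) : Prop :=
  exists2 z', Z z' /\ {in D, forall e, z' e = false} & z =1 z' \o val.

Lemma is_code_restrict D Z : is_code Z -> is_code (restrict_code (D := D) Z).
Proof.
move=> cZ; split=> [z z' zz' [z1 Z1 E]||z z' [z1 Z1 E] [z2 Z2 E']].
- by exists z1 => // e; rewrite -zz'.
- by exists (fun=> false) => //; apply: code0.
- by exists (fun e => z1 e (+) z2 e); [apply: codeD | move=> e; rewrite E E'].
Qed.

Lemma is_code_shorten D Z : is_code Z -> is_code (shorten_code (D := D) Z).
Proof.
move=> cZ; split=> [z z' zz' [z1 Z1 E]||z z' [z1 [Z1 D1] E] [z2 [Z2 D2] E']].
- by exists z1 => // e; rewrite -zz'.
- by exists (fun=> false) => //; split=> //; apply: code0.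
- exists (fun e => z1 e (+) z2 e); last by move=> e; rewrite E E'.
  by split=> [|e eD]; [apply: codeD | rewrite D1 // D2].
Qed.

Lemma coded_delete D Z M : is_code Z -> coded Z M ->
  coded (shorten_code Z) (delete M D).
Proof.
move=> cZ ZM X; rewrite inE; apply: iff_trans (ZM _) _; split=> H z.
  move=> [z' [Zz' z'D] E] zX e; rewrite E /=; apply: H => // f z'f.
  have [/z'D|fD] := boolP (f \in D); first by rewrite z'f.
  by apply/imsetP; exists (Sub f fD) => //; apply: zX; rewrite E.
move=> Zz zX e.
have zD : {in D, forall e, z e = false}.
  by move=> f fD; apply/negbTE/negP => /zX/imsetP[g _ E]; move: (valP g); rewrite -E fD.
have [/zD//|eD] := boolP (e \in D).
apply: (H (z \o val) _ _ (Sub e eD)); first by exists z.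
by move=> f /zX /imsetP[g gX /val_inj->].
Qed.

Lemma rowcoded_delete D W M : rowcoded W M ->
  rowcoded (restrict_code W) (delete M D).
Proof.
move=> WM X; rewrite inE; apply: iff_trans (WM _) _; split=> H e eX.
  have [|w Ww wX] := H (val e); first exact: imset_f.
  exists (w \o val); first by exists w.
  by move=> f fX /=; rewrite wX ?(inj_eq val_inj) ?imset_f.
have /imsetP[f fX ->] := eX; have [w [w' Ww' E] wX] := H f fX.
exists w' => // _ /imsetP[g gX ->]; move: (wX g gX).
by rewrite E /= => ->; rewrite (inj_eq val_inj).
Qed.

Lemma coded_contract C Z M : is_code Z -> coded Z M ->
  coded (restrict_code Z) (contract M C).
Proof.
move=> cZ ZM; apply: coded_dual (is_code_restrict _ cZ) _.
by apply: rowcoded_delete; apply: rowcoded_dual.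
Qed.

Lemma rowcoded_contract C W M : is_code W -> rowcoded W M ->
  rowcoded (shorten_code W) (contract M C).
Proof.
move=> cW WM; apply: rowcoded_dual (is_code_shorten _ cW) _.
by apply: coded_delete => //; apply: coded_dual.
Qed.

End Minors.

(** * Transport of codes along isomorphisms *)

Section Transport.
Variables (T U : finType) (f : T -> U) (g : U -> T).
Hypotheses (fK : cancel f g) (gK : cancel g f).

Lemma is_code_comp (Z : (U -> bool) -> Prop) :
  is_code Z -> is_code (fun z : T -> bool => Z (z \o g)).
Proof.
move=> cZ; split; [|exact: code0|by move=> z z'; apply: codeD].
by move=> z z' E; apply: code_ext => // e; apply: E.
Qed.

Variables (M : matroid T) (N : matroid U).
Implicit Types Z W : (U -> bool) -> Prop.

Lemma coded_iso Z : is_code Z ->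
  (forall X : {set T}, (f @: X \in indep N) = (X \in indep M)) ->
  coded Z N -> coded (fun z => Z (z \o g)) M.
Proof.
move=> cZ iso ZN X; rewrite -iso; apply: iff_trans (ZN _) _; split=> H z.
  move=> Zz zX e; rewrite -[e]fK; apply: H Zz _ (f e) => u /zX guX.
  by apply/imsetP; exists (g u) => //; rewrite gK.
move=> Zz zX u; rewrite -[u]gK; apply: (H (z \o f)).
  by apply: code_ext Zz => // e /=; rewrite gK.
by move=> e /zX /imsetP[e' e'X /(can_inj fK)->].
Qed.

Lemma rowcoded_iso W : is_code W ->
  (forall X : {set T}, (f @: X \in indep N) = (X \in indep M)) ->
  rowcoded W N -> rowcoded (fun w => W (w \o g)) M.
Proof.
move=> cW iso WN X; rewrite -iso; apply: iff_trans (WN _) _; split=> H e eX.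
  have [|w Ww wX] := H (f e); first exact: imset_f.
  exists (w \o f); first by apply: code_ext Ww => // u /=; rewrite gK.
  by move=> e' e'X /=; rewrite wX ?imset_f // (can_eq fK).
have /imsetP[e' e'X ->] := eX; have [w Ww wX] := H e' e'X.
exists (w \o g) => // _ /imsetP[e2 e2X ->] /=.
by rewrite fK wX // (can_eq fK).
Qed.

Lemma iso_rowcoded W : is_code W -> rowcoded (fun w => W (w \o g)) M ->
  rowcoded W N -> matroid_iso M N.
Proof.
move=> cW WM WN; exists f; first by exists g.
move=> X; apply/idP/idP => [/WN H|/WM H]; [apply/WM | apply/WN] => e eX.
  have [|w Ww wX] := H (f e); first exact: imset_f.
  exists (w \o f); first by apply: code_ext Ww => // u /=; rewrite gK.
  by move=> e' e'X /=; rewrite wX ?imset_f // (can_eq fK).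
have /imsetP[e' e'X ->] := eX; have [w Ww wX] := H e' e'X.
exists (w \o g) => // _ /imsetP[e2 e2X ->] /=.
by rewrite fK wX // (can_eq fK).
Qed.

End Transport.

(** * Cuts and even edge sets of a graph *)

Section CutsAndEvenSets.
Variables (T V : finType) (s t : T -> V).
Implicit Types (p q : V -> bool) (z w : T -> bool).

Definition delta p e : bool := p (s e) (+) p (t e).

Definition cut w : Prop := exists p, w =1 delta p.

(** Orthogonality to all cuts amounts to even degree at every vertex, a loop counting twice. *)
Definition even z : Prop :=
  forall p, \big[addb/false]_e (z e && delta p e) = false.

Lemma deltaD p q e : delta (fun v => p v (+) q v) e = delta p e (+) delta q e.
Proof. by rewrite /delta addbACA. Qed.

Lemma is_code_cut : is_code cut.
Proof.
split=> [w w' E [p wp]||w w' [p wp] [q wq]].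
- by exists p => e; rewrite -E.
- by exists (fun=> false).
- by exists (fun v => p v (+) q v) => e; rewrite wp wq deltaD.
Qed.

Lemma is_code_even : is_code even.
Proof.
split=> [z z' E zz p||z z' zz zz' p].
- by rewrite -[RHS](zz p); apply: eq_bigr => e _; rewrite E.
- by move=> p; rewrite big1.
- under eq_bigr do rewrite andb_addl.
  by rewrite big_split /= zz zz'.
Qed.

End CutsAndEvenSets.

Local Open Scope ring_scope.
Import GRing.Theory.

Lemma F2_addb (a b : bool) : (a (+) b)%:R = a%:R + b%:R :> 'F_2.
Proof. by case: a b => [] []; apply/val_inj. Qed.

Lemma F2_eq0 (b : bool) : (b%:R == 0 :> 'F_2) = ~~ b.
Proof. by case: b. Qed.

Lemma F2_big_addb (I : finType) (P : pred I) (F : I -> bool) :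
  (\big[addb/false]_(i | P i) F i)%:R = \sum_(i | P i) (F i)%:R :> 'F_2.
Proof. by apply: (big_morph (fun b : bool => b%:R) F2_addb). Qed.

Lemma coded_vector_matroid (T : finType) r (A : T -> 'cV['F_2]_r) :
  coded (fun z => zero_sum A [set e | z e]) (vector_matroid A).
Proof.
move=> X; split=> [/vector_indep_F2P H z z0 zX e|H].
  have {}H : [set e | z e] = set0.
    by apply: H (eqP z0); apply/subsetP => f; rewrite inE; apply: zX.
  by have /setP/(_ e) := H; rewrite !inE.
apply/vector_indep_F2P => S SX S0; apply/setP => e; rewrite inE.
apply: (H (fun e => e \in S)); last by move=> f /(subsetP SX).
by apply/eqP; rewrite -[RHS]S0; apply: eq_bigl => f; rewrite inE.
Qed.

Lemma is_code_zero_sum (T : finType) r (A : T -> 'cV['F_2]_r) :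
  is_code (fun z => zero_sum A [set e | z e]).
Proof.
have E z : \sum_(e in [set e | z e]) A e = \sum_e (z e)%:R *: A e.
  rewrite big_mkcond; apply: eq_bigr => e _; rewrite inE.
  by case: (z e); rewrite ?scale1r ?scale0r.
split=> [z z' zz'||z z']; rewrite /zero_sum !E.
- move=> /eqP z0; apply/eqP; rewrite -[RHS]z0.
  by apply: eq_bigr => e _; rewrite zz'.
- by rewrite big1 // => e _; rewrite scale0r.
- move=> /eqP z0 /eqP z0'; under eq_bigr do rewrite F2_addb scalerDl.
  by rewrite big_split /= z0 z0' addr0.
Qed.

Section CycleMatroidCodes.
Variable G : graph.
Let s (e : edge G) := (ends e).1.
Let t (e : edge G) := (ends e).2.

Lemma zero_sum_incidence (z : edge G -> bool) :
  zero_sum (@incidence G) [set e | z e] <-> even s t z.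
Proof.
(* Left multiplication by [c p] turns the incidence column of an edge into its value under [delta];
   a single vertex [p] reads off one coordinate. *)
pose c (p : vertex G -> bool) : 'rV['F_2]_#|vertex G| := \row_i (p (enum_val i))%:R.
have cu p v : (c p *m unit_col v) 0 0 = (p v)%:R.
  rewrite mxE (bigD1 (enum_rank v)) //= !mxE enum_rankK eqxx mulr1 big1 ?addr0 //.
  move=> i iv; rewrite !mxE -(inj_eq enum_rank_inj) enum_valK (negbTE iv).
  by rewrite mulr0.
have ci p e : (c p *m incidence e) 0 0 = (delta s t p e)%:R.
  by rewrite mulmxDr mxE !cu /delta F2_addb.
have cz p : (c p *m \sum_(e in [set e | z e]) incidence e) 0 0 =
    (\big[addb/false]_e (z e && delta s t p e))%:R.
  rewrite F2_big_addb mulmx_sumr summxE big_mkcond; apply: eq_bigr => e _.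
  by rewrite inE ci; case: (z e).
split=> [/eqP z0 p|H].
  by apply/negbTE; rewrite -F2_eq0 -cz z0 mulmx0 mxE.
apply/eqP/colP => i; have := cz (pred1 (enum_val i)); rewrite H !mxE.
move=> E; rewrite -[RHS]E {E}.
rewrite (bigD1 i) //= !mxE /= eqxx mul1r [X in _ + X]big1 ?addr0 // => j ji.
by rewrite !mxE /= (inj_eq enum_val_inj) (negbTE ji) mul0r.
Qed.

Lemma coded_cycle_matroid : coded (even s t) (cycle_matroid G).
Proof.
move=> X; rewrite /= cycle_indepE.
have /eq_coded := coded_vector_matroid (@incidence G); apply.
exact: zero_sum_incidence.
Qed.

Lemma rowcoded_cycle_matroid : rowcoded (cut s t) (cycle_matroid G).
Proof.
move=> X; split=> [|H].
  rewrite /= cycle_indepE inE => fX e eX.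
  set L := [seq _ | _ <- _] in fX.
  have szL : size L == #|X| by rewrite size_map -cardE.
  have eX' : e \in enum X by rewrite mem_enum.
  have LE (f : edge G) (fX' : f \in X) : L`_(index f (enum X)) = incidence f.
    by rewrite (nth_map e) ?nth_index ?index_mem ?mem_enum.
  have lt (f : edge G) (fX' : f \in X) : (index f (enum X) < #|X|)%N.
    by rewrite cardE index_mem mem_enum.
  (* [g] is the coordinate of [e] with respect to the free columns of [X], a linear form on the
     whole space; its values at the unit columns define the vertex set of the required cut. *)
  pose i := Ordinal (lt e eX); pose g := @coord _ _ _ (Tuple szL) i.
  pose p v := g (unit_col v) != 0.
  have gi f : f \in X -> g (incidence f) = (f == e)%:R.
    move=> fX'; rewrite -(LE f fX').
    rewrite [LHS](@coord_free _ _ _ (Tuple szL) (Ordinal (lt f fX')) i fX).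
    congr (_%:R); rewrite -val_eqE /=; congr nat_of_bool.
    apply/eqP/eqP => [|-> //] E.
    by rewrite -(nth_index e eX') -E nth_index ?mem_enum.
  exists (delta s t p); first by exists p.
  move=> f fX'; have := gi f fX'; rewrite /incidence /g linearD -!/(g _) => E.
  have : (delta s t p f)%:R = (f == e)%:R :> 'F_2.
    by rewrite -E F2_addb -!F2E.
  by case: (delta _ _ _ _) (f == e) => [] [] // /eqP.
apply/coded_cycle_matroid => z Zz zX e; apply/negbTE/negP => ze.
have [w [p wp] wX] := H e (zX e ze); have := Zz p.
rewrite (bigD1 e) //= -wp wX ?zX // eqxx ze big1 // => f fe.
by case: (boolP (z f)) => //= /zX fX; rewrite -wp wX // (negbTE fe).
Qed.

End CycleMatroidCodes.

Local Close Scope ring_scope.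

Lemma even_reindex (T U V : finType) (f : T -> U) (g : U -> T) (s t : U -> V) z :
  cancel f g -> cancel g f -> even s t (z \o g) <-> even (s \o f) (t \o f) z.
Proof.
move=> fK gK; split=> H p; rewrite -[RHS](H p).
  by rewrite [RHS](reindex f) /=; [apply: eq_bigr => e _; rewrite fK | exists g => e].
by rewrite [RHS](reindex g) /=; [apply: eq_bigr => e _; rewrite /delta /= gK | exists f => e].
Qed.

Lemma cut_reindex (T U V : finType) (f : T -> U) (g : U -> T) (s t : U -> V) w :
  cancel f g -> cancel g f -> cut s t (w \o g) <-> cut (s \o f) (t \o f) w.
Proof.
move=> fK gK; split=> -[p wp]; exists p => e; last by rewrite /= wp /delta /= gK.
by have := wp (f e); rewrite /= fK.
Qed.

Lemma graphic_codes (T : finType) (M : matroid T) : graphic M ->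
  exists V : finType, exists s t : T -> V,
    coded (even s t) M /\ rowcoded (cut s t) M.
Proof.
case=> G [f [g fK gK] iso].
exists (vertex G), (fst \o @ends G \o f), (snd \o @ends G \o f); split.
  apply: eq_coded (coded_iso fK gK (is_code_even _ _) iso (@coded_cycle_matroid G)).
  by move=> z; apply: even_reindex.
apply: eq_rowcoded (rowcoded_iso fK gK (is_code_cut _ _) iso (@rowcoded_cycle_matroid G)).
by move=> z; apply: cut_reindex.
Qed.

Lemma rowcoded_graphic (T V : finType) (s t : T -> V) (M : matroid T) :
  rowcoded (cut s t) M -> graphic M.
Proof.
move=> H; exists (Graph (fun e => (s e, t e))).
pose G := Graph (fun e => (s e, t e)).
apply: (@iso_rowcoded _ T id id _ _ M (cycle_matroid G) _ (is_code_cut s t)) => //.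
exact: (@rowcoded_cycle_matroid G).
Qed.

(** * The cycle space of the splitting *)

Definition split_code (T : finType) (Z : (T -> bool) -> Prop) x y
  (w : option T -> bool) : Prop :=
  Z (w \o Some) /\ w None = w (Some x) (+) w (Some y).

Lemma is_code_split (T : finType) (Z : (T -> bool) -> Prop) x y :
  is_code Z -> is_code (split_code Z x y).
Proof.
move=> cZ; split=> [w w' E [Zw wN]||w w' [Zw wN] [Zw' wN']].
- by split; [apply: (code_ext cZ _ Zw) => e /= | rewrite -!E].
- by split=> //; apply: code0.
- by split; [apply: codeD Zw Zw' | rewrite wN wN' addbACA].
Qed.

(** The splitting uses an arbitrarily chosen representation of [M], and [coded_uniq] identifies its
    zero-sum words with the even sets. The added row then forces the coordinate at [None]. *)
Lemma coded_elem_split (T V : finType) (s t : T -> V) (M : matroid T)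
    (hM : binary M) x y : coded (even s t) M -> x != y ->
  coded (split_code (even s t) x y) (elem_split hM x y).
Proof.
move=> sM xy; set A := tagged (xchoose hM).
have AM : indep (vector_matroid A) = indep M by have /eqP := xchooseP hM.
have cA : coded (fun z => zero_sum A [set e | z e]) M.
  by move=> X; rewrite -AM; apply: coded_vector_matroid.
apply: eq_coded (coded_vector_matroid _) => z; rewrite /split_code zero_sum_split.
have -> : Some @^-1: [set e | z e] = [set e | (z \o Some) e].
  by apply/setP => e; rewrite !inE.
have -> : (\sum_(e in [set e | z e])
      (if e is Some e then (e \in [set x; y])%:R else 1) == 0 :> 'F_2)%R =
    (z None == z (Some x) (+) z (Some y)).
  pose F (e : option T) : bool :=
    z e && (if e is Some e then e \in [set x; y] else true).
  have -> : (\sum_(e in [set e | z e])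
      (if e is Some e then (e \in [set x; y])%:R else 1) =
      (\big[addb/false]_e F e)%:R :> 'F_2)%R.
    rewrite F2_big_addb big_mkcond; apply: eq_bigr => -[e|] _;
      by rewrite inE /F; case: (z _).
  rewrite F2_eq0 (bigD1 None) //= (bigD1 (Some x)) //= (bigD1 (Some y)) /=; last first.
    by rewrite (inj_eq Some_inj) eq_sym xy.
  rewrite /F !inE !eqxx orbT !andbT big1; last first.
    case=> //= e /andP[/eqP ex /eqP ey]; rewrite !inE.
    by case: eqP ex => [->//|_] _; case: eqP ey => [->//|_] _; rewrite andbF.
  by rewrite addbF; case: (z _) (z _) (z _) => [] [] [].
split=> [/andP[zz /eqP ->]|[zz ->]].
  by split=> //; apply/(coded_uniq (is_code_zero_sum A) (is_code_even s t) cA sM).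
rewrite eqxx andbT.
by apply/(coded_uniq (is_code_zero_sum A) (is_code_even s t) cA sM).
Qed.

(** * A simple graph of minimum degree three has a K4 model *)

Section K4Models.
Variable V : finType.
Implicit Types (g h : rel V) (r : V -> V) (a b c d u v w z : V).

(* The fibers of beta over 'I_4 are the four branch sets; vertices mapped to None
   are deleted. *)
Definition k4_model g : Prop := exists beta : V -> option 'I_4,
  (forall i j : 'I_4, i != j ->
     exists a b, [/\ beta a = Some i, beta b = Some j & g a b]) /\
  (forall a b, beta a = beta b -> beta a != None ->
     connect [rel c d | g c d && (beta c == beta d)] a b).

(** The vertex type stays [V]: vertices outside the image of [r] merely become isolated, and loops
    are dropped. *)
Definition contraction g r : rel V := [rel c d |
  (c != d) && [exists a, exists b, [&& r a == c, r b == d & g a b]]].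

Lemma contractionP g r c d : reflect
  (c != d /\ exists a b, [/\ r a = c, r b = d & g a b]) (contraction g r c d).
Proof.
apply: (iffP andP) => -[cd H]; split=> //.
  have /existsP[a /existsP[b /and3P[/eqP ? /eqP ? gab]]] := H.
  by exists a, b.
have [a [b [rac rbd gab]]] := H.
by apply/existsP; exists a; apply/existsP; exists b; rewrite rac rbd !eqxx.
Qed.

(** Such an [r] contracts disjoint stars centred at its fixed points, so its nonempty fibres are
    connected. *)
Definition star_map g r : Prop :=
  (forall a, r (r a) = r a) /\ (forall a, r a = a \/ g a (r a)).

Lemma k4_model_sub g h : subrel g h -> k4_model g -> k4_model h.
Proof.
move=> gh [beta [H1 H2]]; exists beta; split=> [i j /H1[a [b [? ? /gh]]]|a b ab na].
  by exists a, b.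
apply: connect_sub (H2 a b ab na) => c d /andP[/gh cd E].
by apply: connect1; rewrite /= cd.
Qed.

Lemma k4_model_contraction g h r : symmetric g -> star_map g r ->
  subrel h (contraction g r) -> k4_model h -> k4_model g.
Proof.
move=> gC [rr rg] hg /(k4_model_sub hg)[beta [H1 H2]]; exists (beta \o r).
set R := [rel c d | _].
have RC : connect_sym R.
  by apply: sym_connect_sym => c d; rewrite /R /= gC eq_sym.
have Rr a : connect R a (r a).
  case: (rg a) => [->//|ga]; apply: connect1.
  by rewrite /R /= ga rr /=.
have gR c d : contraction g r c d -> beta c = beta d -> connect R c d.
  move=> /contractionP[_ [a [b [<- <- gab]]]] E.
  apply: (connect_trans (y := b)); last exact: Rr.
  rewrite RC; apply: (connect_trans (y := a)); last exact: Rr.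
  by apply: connect1; rewrite /R /= gC gab E eqxx.
split=> [i j /H1[c [d [ai bj /contractionP[_ [a [b [ra rb gab]]]]]]]|a b ab na].
  by exists a, b; rewrite /= ra rb.
apply: connect_trans (Rr a) _; rewrite RC; apply: connect_trans (Rr b) _.
rewrite RC; move: (r a) (r b) (H2 _ _ ab na); apply: connect_sub => c d /andP[cd /eqP E].
exact: gR.
Qed.

Definition nb g a : {set V} := [set b | g a b].

Lemma in_nb g a b : (b \in nb g a) = g a b.
Proof. by rewrite inE. Qed.

Lemma in_nbD1 g a b c : (c \in nb g a :\ b) = (c != b) && g a c.
Proof. by rewrite !inE. Qed.

Lemma card_set3 a b c : a != b -> a != c -> b != c -> #|[set a; b; c]| = 3.
Proof.
move=> ab ac bc; rewrite -setUA cardsU1 cards2 !inE negb_or.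
by rewrite ab ac bc.
Qed.

Lemma contraction_sym g r : symmetric g -> symmetric (contraction g r).
Proof.
move=> gC; suff H c d : contraction g r c d -> contraction g r d c.
  by move=> c d; apply/idP/idP; apply: H.
move=> /contractionP[cd [a [b [ra rb gab]]]]; apply/contractionP.
by split; [rewrite eq_sym | exists b, a; rewrite gC].
Qed.

Lemma contraction_irr g r : irreflexive (contraction g r).
Proof. by move=> c; rewrite /contraction /= eqxx. Qed.

Definition non_isolated g : {set V} := [set a | nb g a != set0].

Lemma non_isolated_contraction g r u : symmetric g -> star_map g r ->
  u \in non_isolated g -> r u != u ->
  #|non_isolated (contraction g r)| < #|non_isolated g|.
Proof.
move=> gC [rr rg] ug ru; apply: proper_card; apply/properP; split.
  apply/subsetP => c; rewrite !inE => /set0Pn[d]; rewrite inE.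
  move=> /contractionP[_ [a [b [ra rb gab]]]]; apply/set0Pn.
  case: (rg a) => [E|gar]; last by exists a; rewrite inE gC -ra.
  by exists b; rewrite inE -ra E.
exists u => //; rewrite inE negbK; apply/set0Pn => -[d]; rewrite inE.
move=> /contractionP[_ [a [b [ra rb gab]]]].
by move: ru; rewrite -ra rr eqxx.
Qed.

(** Degree zero is left out because contracted vertices stay in [V] as isolated ones. *)
Definition few_nbs g a := 0 < #|nb g a| < 3.

(* [step] is the induction hypothesis for the minors of a counterexample g. *)
Section Step.
Variable g : rel V.
Hypotheses (gC : symmetric g) (gI : irreflexive g) (gn : forall a, ~~ few_nbs g a).
Hypothesis step : forall r u, star_map g r -> u \in non_isolated g -> r u != u ->
  (exists c d, contraction g r c d) -> exists a, few_nbs (contraction g r) a.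

Lemma nb_ge3 a b : g a b -> 3 <= #|nb g a|.
Proof.
move=> gab; have := gn a; rewrite /few_nbs.
have -> : 0 < #|nb g a| by apply/card_gt0P; exists b; rewrite inE.
by rewrite -leqNgt.
Qed.

Lemma neq_edge a b : g a b -> a != b.
Proof. by move=> gab; apply: contraTneq gab => ->; rewrite gI. Qed.

(** Contracting uv leaves a vertex [a] with one or two neighbours. If [a] is not the merged vertex,
    it has lost a neighbour, so it was adjacent to both ends and had degree three. If it is, the
    other neighbours of [u] and those of [v], at least two each, both fill its neighbourhood and
    hence coincide. *)
Lemma edge_contraction u v : g u v ->
  (exists w, [/\ g u w, g v w & #|nb g w| = 3]) \/
  (nb g u :\ v = nb g v :\ u /\ #|nb g u| = 3).
Proof.
move=> guv; pose r x := if x == v then u else x.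
have uv := neq_edge guv.
have rE x : x != v -> r x = x by rewrite /r => /negbTE->.
have rv : r v = u by rewrite /r eqxx.
have r_star : star_map g r.
  split=> [a|a]; rewrite /r; case: (eqVneq a v) => av.
  - by rewrite (negbTE uv).
  - by rewrite (negbTE av).
  - by right; rewrite av gC.
  - by left.
have nbD1 a b : g a b -> 2 <= #|nb g a :\ b|.
  by move=> gab; have := nb_ge3 gab; rewrite (cardsD1 b) inE gab.
have [] := step r_star (u := v).
- by rewrite inE; apply/set0Pn; exists u; rewrite inE gC.
- by rewrite rv.
- have /card_gt0P[w] : 0 < #|nb g u :\ v| by apply: leq_trans (nbD1 _ _ guv).
  rewrite !inE => /andP[wv guw]; exists u, w; apply/contractionP.
  split; first exact: neq_edge.
  by exists u, w; rewrite !rE.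
move=> a /andP[/card_gt0P[b]]; rewrite inE => /contractionP[ab [a' [b' [ra rb gab]]]].
rewrite ltnS => le2.
have av : a != v by rewrite -ra /r; case: (eqVneq a' v).
have sub c : c != v -> c != a -> g a c -> c \in nb (contraction g r) a.
  move=> cv ca gac; rewrite inE; apply/contractionP; split; first by rewrite eq_sym.
  by exists a, c; rewrite !rE.
have [au|au] := eqVneq a u.
  right; move: ra ab le2 av sub; rewrite au => ra ub le2 _ sub.
  have s1 : nb g u :\ v \subset nb (contraction g r) u.
    apply/subsetP => c; rewrite in_nbD1 => /andP[cv guc].
    by apply: sub => //; rewrite eq_sym neq_edge.
  have s2 : nb g v :\ u \subset nb (contraction g r) u.
    apply/subsetP => c; rewrite in_nbD1 in_nb => /andP[cu gvc]; apply/contractionP.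
    split; first by rewrite eq_sym.
    by exists v, c; rewrite rv rE // eq_sym neq_edge.
  have gvu : g v u by rewrite gC.
  have /eqP E1 : nb g u :\ v == nb (contraction g r) u.
    by rewrite eqEcard s1 (leq_trans le2) // nbD1.
  have /eqP E2 : nb g v :\ u == nb (contraction g r) u.
    by rewrite eqEcard s2 (leq_trans le2) // nbD1.
  split; first by rewrite E1 E2.
  have := nb_ge3 guv; rewrite (cardsD1 v) inE guv E1 => ge3.
  by apply/eqP; rewrite eqn_leq ge3 andbT.
left; exists a.
have ra' : a' = a by move: ra; rewrite /r; case: eqP => // _ E; rewrite E eqxx in au.
subst a'; have a3 := nb_ge3 gab.
have gav : g a v.
  apply: contraLR a3 => gav; rewrite -ltnNge ltnS.
  apply: leq_trans le2; apply: subset_leq_card; apply/subsetP => c.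
  rewrite inE => gac; apply: sub => //; last by rewrite eq_sym neq_edge.
  by apply: contraNneq gav => <-.
have D1 : nb g a :\ v \subset nb (contraction g r) a.
  apply/subsetP => c; rewrite in_nbD1 => /andP[cv gac].
  by apply: sub => //; rewrite eq_sym neq_edge.
have cD1 : #|nb g a| = #|nb g a :\ v|.+1 by rewrite (cardsD1 v) inE gav.
have na3 : #|nb g a| = 3.
  apply/eqP; rewrite eqn_leq a3 andbT cD1 ltnS.
  exact: leq_trans (subset_leq_card D1) le2.
split=> //; last by rewrite gC.
rewrite gC; apply: contraTT le2 => gau; rewrite -ltnNge -{1}na3 cD1.
have -> : #|nb g a :\ v|.+1 = #|u |: (nb g a :\ v)|.
  by rewrite cardsU1 !inE (negbTE gau) andbF.
apply: subset_leq_card; rewrite subUset D1 sub1set inE andbT.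
by apply/contractionP; split=> //; exists a, v; rewrite rv rE.
Qed.

Lemma common_nb u v : g u v -> exists w, g u w /\ g v w.
Proof.
move=> guv; have [[w [? ? _]]|[E n3]] := edge_contraction guv; first by exists w.
have : 0 < #|nb g u :\ v| by move: n3; rewrite (cardsD1 v) inE guv; case: #|_|.
case/card_gt0P => w wu; exists w; move: (wu); rewrite E !inE => /andP[_ ->].
by move: wu; rewrite !inE => /andP[_ ->].
Qed.

Lemma nb3E w a b c : #|nb g w| = 3 -> g w a -> g w b -> g w c ->
  a != b -> a != c -> b != c -> nb g w = [set a; b; c].
Proof.
move=> w3 wa wb wc ab ac bc; apply/esym/eqP; rewrite eqEcard w3 card_set3 //.
by rewrite andbT !subUset !sub1set !inE wa wb wc.
Qed.

Lemma nb3_third w a b : #|nb g w| = 3 -> g w a -> g w b -> a != b ->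
  exists c, [/\ g w c, a != c, b != c & nb g w = [set a; b; c]].
Proof.
move=> w3 wa wb ab.
have : 0 < #|nb g w :\ a :\ b|.
  move: w3; rewrite (cardsD1 a) inE wa (cardsD1 b) !inE wb eq_sym ab.
  by case: #|_|.
case/card_gt0P => c; rewrite !inE => /and3P[cb ca wc]; exists c.
by rewrite ![_ == c]eq_sym; split=> //; apply: nb3E => //; rewrite eq_sym.
Qed.

(* An edge uv with a common neighbour w of degree three forces, through the third
   edge at w, an edge whose two ends have the same closed neighbourhood. *)
Lemma twin_edge a b : g a b -> exists u v w z,
  [/\ w != z, w != u, z != v & nb g u = [set v; w; z] /\ nb g v = [set u; w; z]].
Proof.
have fromII u v : g u v -> nb g u :\ v = nb g v :\ u -> #|nb g u| = 3 ->
    exists u v w z,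
    [/\ w != z, w != u, z != v & nb g u = [set v; w; z] /\ nb g v = [set u; w; z]].
  move=> guv E u3; have gvu : g v u by rewrite gC.
  have v3 : #|nb g v| = 3.
    by rewrite (cardsD1 u) inE gvu -E -u3 [in RHS](cardsD1 v) inE guv.
  have [w [guw gvw]] := common_nb guv.
  have [z [guz vz wz uE]] := nb3_third u3 guv guw (neq_edge gvw).
  have gvz : g v z.
    have : z \in nb g u :\ v by rewrite !inE eq_sym vz.
    by rewrite E !inE => /andP[].
  exists u, v, w, z; split=> //; try by rewrite eq_sym ?neq_edge.
  by split=> //; apply: nb3E => //; apply: neq_edge.
move=> gab; have [[w [gaw gbw w3]]|[E a3]] := edge_contraction gab; last exact: fromII E a3.
have gwa : g w a by rewrite gC.
have gwb : g w b by rewrite gC.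
have [z [gwz az bz wE]] := nb3_third w3 gwa gwb (neq_edge gab).
have [[x [gwx gzx x3]]|[E _]] := edge_contraction gwz; last exact: fromII E w3.
(* [x] is a common neighbour of [w] and [z], so it is [a] or [b]; by symmetry it is [a], and then
   [a] and [w] are the twins. *)
wlog xa : a b gab gaw gbw gwa gwb az bz wE / x = a.
  move=> H; have : x \in nb g w by rewrite inE.
  rewrite wE !inE => /orP[/orP[/eqP xa|/eqP xb]|/eqP xz].
  - exact: (H a b).
  - by apply: (H b a) => //; [rewrite gC | rewrite wE [[set a; b]]setUC].
  - by rewrite xz gI in gzx.
subst x; apply: (fromII a w) => //.
have gaz : g a z by rewrite gC.
have [ab aw wb wz] : [/\ a != b, a != w, w != b & w != z] by rewrite !neq_edge.
have bw : b != w by rewrite eq_sym.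
rewrite wE (nb3E x3 gab gaw gaz) //.
apply/setP => c; rewrite !inE.
have [->|] := eqVneq c a; rewrite ?eqxx ?(negbTE ab) ?(negbTE aw) ?(negbTE az) //=.
by have [->|] := eqVneq c w; rewrite ?eqxx ?(negbTE wb) ?(negbTE wz) ?orbF.
Qed.

End Step.
(** With [u], [v], [q] as the only neighbours of [w], a triangle on the edge wq would have [u] or
    [v] as its apex, but [q] is not among the neighbours of these. *)
Lemma twin_fourth_nb g u v w z : symmetric g -> irreflexive g ->
  (forall a b, g a b -> exists c, g a c /\ g b c) ->
  nb g u = [set v; w; z] -> nb g v = [set u; w; z] -> ~~ g w z ->
  #|nb g w| != 3.
Proof.
move=> gC gI common uE vE wz; apply/negP => /eqP w3.
have gu x : g u x = [|| x == v, x == w | x == z].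
  by rewrite -in_nb uE !inE orbA.
have gv x : g v x = [|| x == u, x == w | x == z].
  by rewrite -in_nb vE !inE orbA.
have gwu : g w u by rewrite gC gu eqxx orbT.
have gwv : g w v by rewrite gC gv eqxx orbT.
have uv : u != v by apply: contraFneq (gI u) => {2}->; rewrite gu eqxx.
have [q [gwq uq vq wE]] := nb3_third w3 gwu gwv uv.
have [x [gwx gqx]] := common w q gwq.
have qw : q == w = false by apply: contraTF gwq => /eqP->; rewrite gI.
have qz : q == z = false by apply: contraTF gwq => /eqP->.
have : x \in nb g w by rewrite inE.
rewrite wE !inE => /orP[/orP[/eqP xu|/eqP xv]|/eqP xq]; move: gqx.
- by rewrite xu gC gu qw qz eq_sym (negbTE vq).
- by rewrite xv gC gv qw qz eq_sym (negbTE uq).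
- by rewrite xq gI.
Qed.

(** As models lift from contractions, in a smallest counterexample every proper contraction that
    keeps an edge creates a vertex of degree one or two. Twins [u], [v] form a K4 with [w], [z] if
    wz is an edge; if not, contracting both of them into [w] creates no such vertex. *)
Lemma k4_model_of_min_degree g : symmetric g -> irreflexive g ->
  (forall a, ~~ few_nbs g a) -> (exists a b, g a b) -> k4_model g.
Proof.
have [n] := ubnP #|non_isolated g|; elim: n => // n IHn in g *.
rewrite ltnS => leg gC gI gn [a0 [b0 gab0]]; apply: NNPP => nk4.
have step r u : star_map g r -> u \in non_isolated g -> r u != u ->
    (exists c d, contraction g r c d) -> exists a, few_nbs (contraction g r) a.
  move=> r_star ug ru [c [d gcd]]; apply: NNPP => nfew; apply: nk4.
  apply: (k4_model_contraction gC r_star (fun _ _ => id)); apply: IHn.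
  - by apply: leq_trans leg; apply: non_isolated_contraction ru.
  - exact: contraction_sym.
  - exact: contraction_irr.
  - by move=> a; apply/negP => Ha; apply: nfew; exists a.
  - by exists c, d.
have common := common_nb gC gI gn step.
have ge3 := nb_ge3 gn.
have [u [v [w [z [wz wu zv [uE vE]]]]]] := twin_edge gC gI gn step gab0.
have gu x : g u x = [|| x == v, x == w | x == z].
  by rewrite -in_nb uE !inE orbA.
have gv x : g v x = [|| x == u, x == w | x == z].
  by rewrite -in_nb vE !inE orbA.
have uv : u != v by apply: contraFneq (gI u) => {2}->; rewrite gu eqxx.
have wv : w != v by apply: contraFneq (gI v) => {2}<-; rewrite gv eqxx orbT.
have zu : z != u by apply: contraFneq (gI u) => {2}<-; rewrite gu eqxx !orbT.
have [gwz|gwz] := boolP (g w z).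
  apply: nk4.
  pose s := [:: u; v; w; z].
  have us : uniq s.
    rewrite /= !inE !negb_or uv wz !andbT.
    by rewrite [u == w]eq_sym [u == z]eq_sym [v == w]eq_sym [v == z]eq_sym wu zu wv zv.
  pose beta x : option 'I_4 := if x \in s then Some (inord (index x s)) else None.
  have idx x : x \in s -> index x s < 4 by rewrite -index_mem.
  have inj a b : beta a = beta b -> beta a != None -> a = b.
    rewrite /beta; case: ifP => // a_s; case: ifP => // b_s [] /(congr1 (@nat_of_ord 4)).
    rewrite (inordK (idx _ a_s)) (inordK (idx _ b_s)) => E _.
    by rewrite -(nth_index u a_s) E nth_index.
  exists beta; split; last by move=> a b ab na; rewrite (inj a b) // connect0.
  pose f (i : 'I_4) := nth u s i.
  have bf i : beta (f i) = Some i.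
    by rewrite /beta /f mem_nth // index_uniq // inord_val.
  move=> i j ij; exists (f i), (f j); split=> //.
  have [guv guw guz] : [/\ g u v, g u w & g u z] by rewrite !gu !eqxx !orbT.
  have [gvw gvz] : g v w /\ g v z by rewrite !gv !eqxx !orbT.
  have : [/\ g v u, g w u, g z u, g w v & g z v /\ g z w].
    by rewrite gC guv gC guw gC guz gC gvw gC gvz gC gwz.
  case=> gvu gwu gzu gwv [gzv gzw].
  by case: i j ij => [[|[|[|[|//]]]] ?] [[|[|[|[|//]]]] ?].
have w4 : 4 <= #|nb g w|.
  rewrite ltn_neqAle eq_sym (twin_fourth_nb gC gI common uE vE gwz) /=.
  by apply: (ge3 w u); rewrite gC gu eqxx orbT.
have z4 : 4 <= #|nb g z|.
  rewrite ltn_neqAle eq_sym (@twin_fourth_nb g u v z w) //=.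
  - by apply: (ge3 z u); rewrite gC gu eqxx !orbT.
  - by rewrite uE -!setUA [[set w] :|: _]setUC.
  - by rewrite vE -!setUA [[set w] :|: _]setUC.
  - by rewrite gC.
(* Contracting u and v into w creates the edge wz and costs w and z one degree. *)
pose r x := if (x == u) || (x == v) then w else x.
have rE x : x != u -> x != v -> r x = x by rewrite /r => /negbTE-> /negbTE->.
have ru : r u = w by rewrite /r eqxx.
have rv : r v = w by rewrite /r eqxx orbT.
have rw : r w = w by rewrite rE.
have rz : r z = z by rewrite rE.
have r_star : star_map g r.
  split=> a; have [->|au] := eqVneq a u.
  - by rewrite ru rw.
  - by have [->|av] := eqVneq a v; [rewrite rv rw | rewrite !rE].
  - by right; rewrite ru gu eqxx orbT.
  - have [->|av] := eqVneq a v; last by left; rewrite rE.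
    by right; rewrite rv gv eqxx orbT.
have gwz' : contraction g r w z.
  by apply/contractionP; split=> //; exists u, z; rewrite ru rz gu eqxx !orbT.
have [] := step r u r_star.
- by rewrite inE; apply/set0Pn; exists w; rewrite inE gu eqxx orbT.
- by rewrite ru.
- by exists w, z.
move=> a /andP[/card_gt0P[b]]; rewrite inE => /contractionP[ab [a' [b' [ra rb gab]]]].
apply/negP; rewrite -leqNgt.
have [au av] : a != u /\ a != v.
  rewrite -ra /r; case: ifP => [_|/negbT]; first by [].
  by rewrite negb_or => /andP.
have sub x : x != u -> x != v -> g a x -> x \in nb (contraction g r) a.
  move=> xu xv gax; rewrite inE; apply/contractionP.
  by split; [apply: contraTneq gax => ->; rewrite gI | exists a, x; rewrite !rE].
(* Of at least four neighbours only [u] and [v] can be lost, and [x] is gained. *)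
have sub4 x : 4 <= #|nb g a| -> x \in nb (contraction g r) a -> ~~ g a x ->
    3 <= #|nb (contraction g r) a|.
  move=> a4 xa gax; apply: (@leq_trans #|x |: (nb g a :\ u :\ v)|).
    rewrite cardsU1 !inE (negbTE gax) !andbF /= add1n ltnS.
    move: a4; rewrite (cardsD1 u) (cardsD1 v (_ :\ _)).
    by case: (u \in _) (v \in _) => [] [] /=; rewrite ?add1n ?add0n // => /ltnW // /ltnW.
  apply: subset_leq_card; rewrite subUset sub1set xa /=.
  by apply/subsetP => y; rewrite !in_setD1 in_nb => /and3P[yv yu]; apply: sub.
have [aw|aw] := eqVneq a w.
  by apply: (sub4 z); rewrite ?aw // inE.
have [az|az] := eqVneq a z.
  by apply: (sub4 w); rewrite ?az 1?gC // inE contraction_sym.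
(* Any remaining vertex is adjacent neither to [u] nor to [v], so it keeps all its neighbours. *)
have {}ra : a' = a.
  by move: ra aw; rewrite /r; case: ifP => // _ <-; rewrite eqxx.
rewrite ra in gab; apply: leq_trans (ge3 _ _ gab) _; apply: subset_leq_card.
apply/subsetP => x; rewrite in_nb => gax; apply: sub => //.
  by apply: contraTneq gax => ->; rewrite gC gu !negb_or av aw.
by apply: contraTneq gax => ->; rewrite gC gv !negb_or au aw.
Qed.

End K4Models.

(** * Dual graphs with two prescribed edges touching *)

Section DualGraph.
Variables T V : finType.
Implicit Types (s t : T -> V) (E : {set T}) (z : T -> bool) (e f x y : T).

Definition adj s t E : rel V := [rel a b | (a != b) &&
  [exists e in E, (s e == a) && (t e == b) || (s e == b) && (t e == a)]].

Definition even_on s t E z : Prop := (forall e, z e -> e \in E) /\ even s t z.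

(* The graph (U, u, v) is a dual of (V, s, t) restricted to E, in which x and y
   share the vertex u x = u y; the edges outside E become loops. *)
Definition dual_touching s t E x y : Prop :=
  exists U : finType, exists u v : T -> U,
    u x = u y /\ forall z, even_on s t E z <-> cut u v z.

Lemma adjP s t E a b : reflect
  (a != b /\ exists2 e, e \in E & s e = a /\ t e = b \/ s e = b /\ t e = a)
  (adj s t E a b).
Proof.
apply: (iffP andP) => -[ab H]; split=> //.
  have /exists_inP[e eE /orP H'] := H; exists e => //.
  by case: H' => /andP[/eqP ? /eqP ?]; [left|right].
have [e eE H'] := H; apply/exists_inP; exists e => //.
by case: H' => -[-> ->]; rewrite !eqxx ?orbT.
Qed.

Lemma adj_sym s t E : symmetric (adj s t E).
Proof.
suff H a b : adj s t E a b -> adj s t E b a by move=> a b; apply/idP/idP; apply: H.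
move=> /adjP[ab [e eE H]]; apply/adjP; split; first by rewrite eq_sym.
by exists e => //; case: H; [right|left].
Qed.

Lemma adj_irr s t E : irreflexive (adj s t E).
Proof. by move=> a; rewrite /adj /= eqxx. Qed.

Lemma adj_subset s t E E' : E' \subset E -> subrel (adj s t E') (adj s t E).
Proof.
move=> EE a b /adjP[ab [e eE H]]; apply/adjP; split=> //.
by exists e => //; apply: (subsetP EE).
Qed.

Definition erase e z : T -> bool := fun f => z f && (f != e).

(** The value at a loop is free, so its dual is a pendant edge to the new vertex [None]. It hangs at
    the shared vertex [u x], which also serves when [e] is [x] or [y]. *)
Lemma dual_touching_loop s t E e x y : s e = t e -> e \in E ->
  dual_touching s t (E :\ e) x y -> dual_touching s t E x y.
Proof.
move=> ste eE [U [u [v [uxy H]]]].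
exists (option U), (fun f => Some (if f == e then u x else u f)),
  (fun f => if f == e then None else Some (v f)).
split; first by rewrite -uxy; do 2!case: ifP.
have evE z : even_on s t E z <-> even_on s t (E :\ e) (erase e z).
  have dE p f : erase e z f && delta s t p f = z f && delta s t p f.
    rewrite /erase /delta; case: eqP => [->|]; last by rewrite andbT.
    by rewrite ste addbb !andbF.
  split=> -[H1 H2]; split=> [f|p].
  - by rewrite /erase !inE => /andP[/H1 -> ->].
  - by rewrite -[RHS](H2 p); apply: eq_bigr => f _; rewrite dE.
  - move=> zf; have [->//|fe] := eqVneq f e.
    by have := H1 f; rewrite /erase zf fe !inE => /(_ isT)/andP[].
  - by rewrite -[RHS](H2 p); apply: eq_bigr => f _; rewrite dE.
move=> z; apply: iff_trans (evE z) _; split=> [/H[p zp]|[p zp]].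
  exists (oapp p (p (u x) (+) z e)) => f; rewrite /delta.
  case: eqP => [->|/eqP fe] /=; first by rewrite addbA addbb.
  by have := zp f; rewrite /erase fe andbT.
have /H[_ evq] : cut u v (delta u v (p \o Some)) by exists (p \o Some).
(* By [H] the cuts of the smaller dual graph vanish outside [E :\ e], so [e] is a loop there. *)
have qe : delta u v (p \o Some) e = false.
  apply/negbTE/negP.
  have /H[q1 _] : cut u v (delta u v (p \o Some)) by exists (p \o Some).
  by move/q1; rewrite !inE eqxx.
apply/H; exists (p \o Some) => f; rewrite /erase zp {1}/delta.
by case: eqP => [->|] /=; rewrite ?andbF ?andbT // qe.
Qed.

Lemma even_on_star s t E z a : even_on s t E z ->
  \big[addb/false]_(e in E) (z e && ((s e == a) (+) (t e == a))) = false.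
Proof.
move=> [H1 H2]; rewrite -[RHS](H2 (pred1 a)) big_mkcond; apply: eq_bigr => e _.
by rewrite /delta /=; case: ifP => // /negbT eE; rewrite (contraNF (H1 e) eE).
Qed.

Definition touches s t a e := (s e == a) (+) (t e == a).

(** Parity at [a] forces the value zero at [e]. Hence [e] is a loop of the dual graph, as it already
    is once removed from [E], and the same dual graph serves. *)
Lemma even_on_pendant s t E z a e : e \in E -> touches s t a e ->
  (forall f, f \in E -> touches s t a f -> f = e) ->
  even_on s t E z <-> even_on s t (E :\ e) z.
Proof.
move=> eE ae aE; split=> [H|[H1 H2]]; last first.
  by split=> // f /H1; rewrite inE => /andP[].
have ze : z e = false.
  have := even_on_star a H; rewrite (bigD1 e) //= -/(touches s t a e) ae andbT.
  rewrite big1 ?addbF // => f /andP[fE fe]; rewrite -/(touches s t a f).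
  have -> : touches s t a f = false by apply: contraNF fe => /(aE f fE)->.
  exact: andbF.
case: H => H1 H2; split=> // f zf; rewrite !inE H1 // andbT.
by apply: contraTneq zf => ->; rewrite ze.
Qed.

(* In the dual graph f is subdivided into e and f. The half called f keeps the end
   [u f], except when {x, y} = {e, f}: then both first ends are the new vertex. *)
Lemma dual_touching_parallel s t E e f x y : e \in E -> f \in E -> e != f ->
  (forall p, delta s t p e = delta s t p f) ->
  (e \in [:: x; y] -> f \in [:: x; y]) ->
  dual_touching s t (E :\ e) x y -> dual_touching s t E x y.
Proof.
move=> eE fE ef dE efxy [U [u [v [uxy H]]]]; pose b := e \in [:: x; y].
pose u' g := if g == e then None else if g == f then
  (if b then None else Some (u f)) else Some (u g).
pose v' g := if g == e then Some (v f) else if g == f then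
  (if b then Some (u f) else None) else Some (v g).
exists (option U), u', v'; split.
  have fe : (f == e) = false by rewrite eq_sym (negbTE ef).
  rewrite /u'; have [xe|xe] := eqVneq x e.
    have bT : b by rewrite /b !inE xe eqxx.
    have := efxy bT; rewrite !inE xe fe => /eqP <-.
    by rewrite fe eqxx bT.
  have [ye|ye] := eqVneq y e.
    have bT : b by rewrite /b !inE ye eqxx orbT.
    have := efxy bT; rewrite !inE ye fe orbF => /eqP <-.
    by rewrite eqxx bT.
  have -> : b = false by rewrite /b !inE ![e == _]eq_sym (negbTE xe) (negbTE ye).
  have E1 g : (if g == f then Some (u f) else Some (u g)) = Some (u g).
    by case: eqP => [->|].
  by rewrite !E1 uxy.
(* Evenness does not distinguish [e] from [f]: [z'] moves [e] onto [f], and the value obtained there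
   is that of the dual edge before its subdivision. *)
pose z' z g := if g == e then false else if g == f then z f (+) z e else z g.
have evE z : even_on s t E z <-> even_on s t (E :\ e) (z' z).
  have dz p : \big[addb/false]_g (z' z g && delta s t p g) =
      \big[addb/false]_g (z g && delta s t p g).
    rewrite [LHS](bigD1 e) //= [in LHS](bigD1 f) 1?eq_sym //=.
    rewrite [RHS](bigD1 e) //= [in RHS](bigD1 f) 1?eq_sym //=.
    rewrite {1 2}/z' eqxx [f == e]eq_sym (negbTE ef) eqxx /= dE.
    rewrite andb_addl [RHS]addbA [_ (+) (z f && _)]addbC; congr (_ (+) _).
    by apply: eq_bigr => g /andP[/negbTE ge /negbTE gf]; rewrite /z' ge gf.
  split=> -[H1 H2]; split=> [g|p].
  - rewrite /z' !inE; have [//|ge] := eqVneq g e.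
    by have [->//|gf] := eqVneq g f; apply: H1.
  - by rewrite dz.
  - move=> zg; have [->//|ge] := eqVneq g e; have [->//|gf] := eqVneq g f.
    have := H1 g; rewrite /z' (negbTE ge) (negbTE gf) => /(_ zg).
    by rewrite !inE => /andP[].
  - by rewrite -dz.
move=> z; apply: iff_trans (evE z) _; split=> [/H[p zp]|[p zp]].
  exists (oapp p (p (u f) (+) z f)) => g.
  have zf : z f (+) z e = p (u f) (+) p (v f).
    by have := zp f; rewrite /z' eq_sym (negbTE ef) eqxx.
  rewrite /delta /u' /v'; have [->|ge] := eqVneq g e.
    have -> : z e = z f (+) (z f (+) z e) by rewrite addbA addbb.
    rewrite zf; case: (b) => /=;
    by case: (z f) (p (u f)) (p (v f)) => [] [] [].
  have [->|gf] := eqVneq g f.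
    by case: (b) => /=; case: (z f) (p (u f)) => [] [].
  by rewrite /=; have := zp g; rewrite /z' (negbTE ge) (negbTE gf).
have dq : cut u v (delta u v (p \o Some)) by exists (p \o Some).
have qe : delta u v (p \o Some) e = false.
  apply/negbTE/negP; have /H[q1 _] := dq.
  by move/q1; rewrite !inE eqxx.
apply/H; exists (p \o Some) => g; rewrite /z'.
have [->//|ge] := eqVneq g e.
have [->|gf] := eqVneq g f; last first.
  by rewrite zp /delta /u' /v' (negbTE ge) (negbTE gf).
rewrite !zp /delta /u' /v' !eqxx [f == e]eq_sym (negbTE ef) /=.
by case: (b); case: (p _) (p _) (p _) => [] [] [].
Qed.

Definition merge (a b c : V) : V := if c == a then b else c.

(** The star of [a] consists of [e] and [f], so parity there says [z e = z f]. The contracted graph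
    tests only vertex sets that do not separate [a] from [b]; every other set differs from one of
    these by the vertex [a] alone. *)
Lemma even_on_contract s t E z a b e f : a != b -> e \in E -> f \in E -> e != f ->
  s e = a /\ t e = b \/ s e = b /\ t e = a -> touches s t a f ->
  (forall g, g \in E -> touches s t a g -> g = e \/ g = f) ->
  even_on s t E z <-> z e = z f /\
    even_on (merge a b \o s) (merge a b \o t) (E :\ e) (erase e z).
Proof.
move=> ab eE fE ef eab af aE; set r := merge a b.
have ae : touches s t a e.
  by rewrite /touches; case: eab => -[-> ->]; rewrite eqxx eq_sym (negbTE ab).
have dr p : delta (r \o s) (r \o t) p e = false.
  rewrite /delta /= /r /merge; case: eab => -[-> ->]; rewrite eqxx eq_sym (negbTE ab);
    exact: addbb.
have star z' : (forall e, z' e -> e \in E) ->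
    \big[addb/false]_g (z' g && delta s t (pred1 a) g) = z' e (+) z' f.
  move=> z'E; rewrite (bigD1 e) //= (bigD1 f) 1?eq_sym //=.
  rewrite /delta /= -!/(touches s t a _) ae af !andbT big1 ?addbF //.
  move=> g /andP[/negP ge /negP gf]; apply/negbTE/negP.
  move=> /andP[/z'E gE ag]; have [/eqP|/eqP] := aE g gE ag; [exact: ge|exact: gf].
have dz p : \big[addb/false]_g (erase e z g && delta (r \o s) (r \o t) p g) =
    \big[addb/false]_g (z g && delta s t (p \o r) g).
  apply: eq_bigr => g _; rewrite /erase; have [->|] := eqVneq g e.
    by rewrite -[delta s t _ e]/(delta (r \o s) (r \o t) p e) dr !andbF.
  by rewrite andbT.
split=> [[H1 H2]|[zef [H1 H2]]].
  split; first by have := H2 (pred1 a); rewrite star //; case: (z e) (z f) => [] [].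
  split=> [g|p]; first by rewrite /erase !inE => /andP[/H1-> ->].
  by rewrite dz.
have zE g : z g -> g \in E.
  move=> zg; have [->//|ge] := eqVneq g e.
  by have := H1 g; rewrite /erase zg ge => /(_ isT); rewrite inE => /andP[].
split=> // p; have := H2 p; rewrite dz => Hp.
have [E0|E1] := eqVneq (p a) (p b).
  rewrite -[RHS]Hp; apply: eq_bigr => g _; congr (_ && _).
  by rewrite /delta /= /r /merge; congr (_ (+) _); case: eqP => // ->.
have pr c : p c = p (r c) (+) (c == a).
  by rewrite /r /merge; case: eqP => [->|];
    [move: E1; case: (p a) (p b) => [] [] | rewrite addbF].
have -> : \big[addb/false]_g (z g && delta s t p g) =
    \big[addb/false]_g (z g && delta s t (p \o r) g) (+)
    \big[addb/false]_g (z g && delta s t (pred1 a) g).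
  rewrite -big_split; apply: eq_bigr => g _ /=; rewrite -andb_addr -deltaD.
  by congr (_ && _); rewrite /delta (pr (s g)) (pr (t g)) /=.
by rewrite Hp star // zef addbb.
Qed.

(* In the dual graph e is added parallel to f. *)
Lemma dual_touching_series s t E x y a b e f : a != b -> e \in E -> f \in E -> e != f ->
  s e = a /\ t e = b \/ s e = b /\ t e = a -> touches s t a f ->
  (forall g, g \in E -> touches s t a g -> g = e \/ g = f) ->
  (forall x y, dual_touching (merge a b \o s) (merge a b \o t) (E :\ e) x y) ->
  dual_touching s t E x y.
Proof.
(* Since [e] receives the ends of [f], a demand on [e] is passed on to [f]; this is why [IH] covers
   all pairs. *)
move=> ab eE fE ef eab af aE IH; pose h x := if x == e then f else x.
have [U [u [v [uxy H]]]] := IH (h x) (h y).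
exists U, (u \o h), (v \o h); split=> // z.
apply: iff_trans (even_on_contract z ab eE fE ef eab af aE) _.
have fe : f == e = false by rewrite eq_sym (negbTE ef).
split=> [[zef /H[p zp]]|[p zp]].
  exists p => g; rewrite /delta /= /h; case: eqP => [->|/eqP ge].
    by have := zp f; rewrite /erase fe andbT zef.
  by have := zp g; rewrite /erase ge andbT.
split; first by rewrite !zp /delta /= /h eqxx fe.
have dq : cut u v (delta u v p) by exists p.
apply/H; exists p => g; rewrite /erase zp /delta /= /h.
case: eqP => [->|_]; last by rewrite andbT.
rewrite andbF; apply/esym/negbTE/negP; have /H[q1 _] := dq.
by move/q1; rewrite !inE eqxx.
Qed.

(** The induction on the number of edges runs over all end maps and all pairs, because a series
    reduction changes both. Each reduction preserves the absence of a K4 model. *)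
Lemma no_k4_dual_touching s t E x y : ~ k4_model (adj s t E) -> dual_touching s t E x y.
Proof.
have [n] := ubnP #|E|; elim: n => // n IHn in s t E x y *; rewrite ltnS => leEn nk4.
have IHd e : e \in E -> forall x y, dual_touching s t (E :\ e) x y.
  move=> eE x' y'; apply: IHn; first by rewrite [#|E|](cardsD1 e) eE in leEn.
  by apply: contra_not nk4; apply: k4_model_sub; apply: adj_subset; apply: subsetDl.
have [E0|[e0 e0E]] := set_0Vmem E.
  exists unit, (fun=> tt), (fun=> tt); split=> // z; split=> [[H1 _]|[p zp]].
    exists (fun=> false) => e; apply/negbTE/negP => /H1.
    by rewrite E0 inE.
  have z0 e : z e = false by rewrite zp /delta addbb.
  split=> [e|p']; first by rewrite z0.
  by rewrite big1 // => e _; rewrite z0.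
have [[e eE ste]|noloop] := classic (exists2 e, e \in E & s e = t e).
  by apply: (dual_touching_loop ste eE); apply: IHd.
have [[e [f [eE fE ef dE]]]|nopar] := classic (exists e f,
    [/\ e \in E, f \in E, e != f & forall p, delta s t p e = delta s t p f]).
  (* An edge of the pair may be removed only if its parallel partner also belongs to the pair; if
     [f] does not belong to it, [f] is the one removed. *)
  have [fxy|fxy] := boolP (f \in [:: x; y]).
    by apply: (dual_touching_parallel eE fE ef) => //; apply: IHd.
  apply: (@dual_touching_parallel _ _ _ f e) => //; first by rewrite eq_sym.
    by rewrite (negbTE fxy).
  exact: IHd.
have [a few] : exists a, few_nbs (adj s t E) a.
  apply: NNPP => nfew; apply: nk4; apply: k4_model_of_min_degree.
  - exact: adj_sym.
  - exact: adj_irr.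
  - by move=> a; apply/negP => ?; apply: nfew; exists a.
  exists (s e0), (t e0); apply/adjP; split; last by exists e0 => //; left.
  by apply/eqP => E0; apply: noloop; exists e0.
(* With no parallel edges left, the edges touching [a] correspond to its neighbours. *)
have joinsP e b : e \in E ->
    s e = a /\ t e = b \/ s e = b /\ t e = a -> forall f, f \in E ->
    s f = a /\ t f = b \/ s f = b /\ t f = a -> f = e.
  move=> eE He f fE Hf; apply/eqP/negPn/negP => ef; apply: nopar.
  exists f, e; split=> // p; rewrite /delta.
  by case: He => -[-> ->]; case: Hf => -[-> ->] //; rewrite addbC.
have touchP e : e \in E -> touches s t a e -> exists2 b, b \in nb (adj s t E) a &
    s e = a /\ t e = b \/ s e = b /\ t e = a.
  move=> eE; rewrite /touches; case: eqP => [sa|sa]; case: eqP => [ta|ta] //= _.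
    exists (t e); last by left.
    by rewrite inE; apply/adjP; split; [apply/eqP => E1; apply: ta | exists e => //; left].
  exists (s e); last by right.
  by rewrite inE; apply/adjP; split; [apply/eqP => E1; apply: sa | exists e => //; right].
have edgeP b : b \in nb (adj s t E) a -> exists e, [/\ e \in E, touches s t a e, a != b &
    s e = a /\ t e = b \/ s e = b /\ t e = a].
  rewrite inE => /adjP[ab [e eE He]]; exists e; split=> //.
  by rewrite /touches; case: He => -[-> ->]; rewrite eqxx eq_sym (negbTE ab).
have [n1|n2] : #|nb (adj s t E) a| = 1 \/ #|nb (adj s t E) a| = 2.
  by move: few; rewrite /few_nbs; case: #|_| => [|[|[|]]] //; [left|right].
- have /cards1P[b nE] : #|nb (adj s t E) a| == 1 by rewrite n1.
  have [|e [eE ae ab He]] := edgeP b; first by rewrite nE inE.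
  have aE f : f \in E -> touches s t a f -> f = e.
    move=> fE /(touchP _ fE)[c]; rewrite nE inE => /eqP-> Hf.
    exact: joinsP eE He f fE Hf.
  have [U [u [v [uxy H]]]] := IHd e eE x y.
  exists U, u, v; split=> // z; apply: iff_trans (H z).
  exact: even_on_pendant eE ae aE.
- have /cards2P[b [c [bc nE]]] : #|nb (adj s t E) a| == 2 by rewrite n2.
  have [|e [eE ae ab He]] := edgeP b; first by rewrite nE !inE eqxx.
  have [|f [fE af ac Hf]] := edgeP c; first by rewrite nE !inE eqxx orbT.
  have ef : e != f.
    apply: contraNneq bc => E1; subst f.
    case: He Hf => -[h1 h2] [] [h3 h4].
    + by rewrite -h2 -h4.
    + by rewrite -h2 h4 -h1 h3 in ac *; rewrite eqxx in ac.
    + by rewrite -h1 h3 in ab; rewrite eqxx in ab.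
    + by rewrite -h1 -h3.
  have aE g : g \in E -> touches s t a g -> g = e \/ g = f.
    move=> gE /(touchP _ gE)[d]; rewrite nE !inE => /orP[] /eqP-> Hg.
      by left; apply: joinsP eE He g gE Hg.
    by right; apply: joinsP fE Hf g gE Hg.
  apply: (dual_touching_series x y ab eE fE ef He af aE) => x' y'.
  set r := merge a b; apply: IHn.
    by rewrite [#|E|](cardsD1 e) eE in leEn.
  have rb : r b = b by rewrite /r /merge eq_sym (negbTE ab).
  have ra : r a = b by rewrite /r /merge eqxx.
  have rE d : d != a -> r d = d by rewrite /r /merge => /negbTE->.
  apply: contra_not nk4; apply: (@k4_model_contraction _ _ _ r).
  + exact: adj_sym.
  + split=> d; have [->|da] := eqVneq d a.
    * by rewrite ra rb.
    * by rewrite !rE.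
    * by right; rewrite ra -in_nb nE !inE eqxx.
    * by left; rewrite rE.
  move=> d d' /adjP[dd [g gE Hg]]; apply/contractionP; split=> //.
  have st : s g != t g.
    by apply/eqP => E1; apply: noloop; exists g => //; case/setD1P: gE.
  have {}gE : g \in E by case/setD1P: gE.
  case: Hg => -[<- <-].
    by exists (s g), (t g); split=> //; apply/adjP; split=> //; exists g => //; left.
  exists (t g), (s g); split=> //; apply/adjP; rewrite eq_sym; split=> //.
  by exists g => //; right.
Qed.

End DualGraph.

(** * Minors isomorphic to M(K4) *)

Section CompleteGraph4.
Local Notation K4 := (complete_graph 4).
Let s (k : edge K4) := (ends k).1.
Let t (k : edge K4) := (ends k).2.

Definition k4_edge (i j : 'I_4) (ij : i < j) : edge K4 := exist _ (i, j) ij.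

Definition k01 : edge K4 := @k4_edge (@Ordinal 4 0 isT) (@Ordinal 4 1 isT) isT.
Definition k02 : edge K4 := @k4_edge (@Ordinal 4 0 isT) (@Ordinal 4 2 isT) isT.
Definition k03 : edge K4 := @k4_edge (@Ordinal 4 0 isT) (@Ordinal 4 3 isT) isT.
Definition k12 : edge K4 := @k4_edge (@Ordinal 4 1 isT) (@Ordinal 4 2 isT) isT.
Definition k13 : edge K4 := @k4_edge (@Ordinal 4 1 isT) (@Ordinal 4 3 isT) isT.
Definition k23 : edge K4 := @k4_edge (@Ordinal 4 2 isT) (@Ordinal 4 3 isT) isT.

Lemma k4_edgeP (k : edge K4) : k \in [:: k01; k02; k03; k12; k13; k23].
Proof.
rewrite !inE -!val_eqE -!pair_eqE /= -!val_eqE.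
by case: k => -[[[|[|[|[|//]]]] ?] [[|[|[|[|//]]]] ?]].
Qed.

Lemma big_k4 (R : Type) (idx : R) (op : Monoid.com_law idx) (F : edge K4 -> R) :
  \big[op/idx]_k F k =
  op (F k01) (op (F k02) (op (F k03) (op (F k12) (op (F k13) (F k23))))).
Proof.
rewrite (perm_big [:: k01; k02; k03; k12; k13; k23]).
  by rewrite !big_cons big_nil Monoid.mulm1.
apply: uniq_perm => //; first exact: index_enum_uniq.
by move=> k; rewrite mem_index_enum k4_edgeP.
Qed.

(* The words z extended by z k01 + z k23 form the simplex code of length 7: splitting
   M(K4) at two opposite edges gives the dual of the Fano matroid. *)
Lemma k4_even_weight z : even s t z -> 4 %| \sum_k z k + (z k01 (+) z k23).
Proof.
move=> H.
have := H (pred1 (@Ordinal 4 0 isT)); have := H (pred1 (@Ordinal 4 1 isT)).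
have := H (pred1 (@Ordinal 4 2 isT)); have := H (pred1 (@Ordinal 4 3 isT)).
rewrite !big_k4 /delta /= -!val_eqE /=.
by case: (z k01) (z k02) (z k03) (z k12) (z k13) (z k23) => [] [] [] [] [] [].
Qed.

(** Every edge lies in such a triangle, and each triangle contains exactly one of the opposite edges
    [k01], [k23]. So no coordinate of the extended code is identically zero, and a graph for F7
    would have no loops. *)
Definition triangle_avoiding (i : 'I_4) (k : edge K4) : bool := (s k != i) && (t k != i).

Lemma even_triangle i : even s t (triangle_avoiding i).
Proof.
move=> p; rewrite big_k4 /triangle_avoiding /delta /= -!val_eqE.
by case: i => [[|[|[|[|//]]]] ?] /=; case: (p _) (p _) (p _) => [] [] [].
Qed.

Lemma triangle_diagonal i : triangle_avoiding i k01 (+) triangle_avoiding i k23.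
Proof. by rewrite /triangle_avoiding /= -!val_eqE; case: i => [[|[|[|[|//]]]] ?]. Qed.

Lemma triangle_through k : exists i, triangle_avoiding i k.
Proof.
have := k4_edgeP k; rewrite !inE.
move=> /predU1P[->|/predU1P[->|/predU1P[->|/predU1P[->|/predU1P[->|/eqP->]]]]].
- by exists (@Ordinal 4 2 isT).
- by exists (@Ordinal 4 1 isT).
- by exists (@Ordinal 4 1 isT).
- by exists (@Ordinal 4 0 isT).
- by exists (@Ordinal 4 0 isT).
- by exists (@Ordinal 4 0 isT).
Qed.

Lemma k4_joins_inj (X : eqType) (b : 'I_4 -> X) (k l : edge K4) : injective b ->
  b (s k) = b (s l) /\ b (t k) = b (t l) \/ b (s k) = b (t l) /\ b (t k) = b (s l) ->
  k = l.
Proof.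
move=> binj [[/binj E1 /binj E2]|[/binj E1 /binj E2]].
  by apply: val_inj; rewrite [val k]surjective_pairing [val l]surjective_pairing; congr pair.
have lt_k : s k < t k := valP k; have lt_l : s l < t l := valP l.
by move: lt_k; rewrite E1 E2 ltnNge ltnW.
Qed.

End CompleteGraph4.

Lemma connect_const (V : finType) (R : rel V) (X : Type) (p : V -> X) a b :
  (forall c d, R c d -> p c = p d) -> connect R a b -> p a = p b.
Proof.
move=> Rp /connectP[q]; elim: q a => [|c q IHq] a /=; first by move=> _ ->.
by move=> /andP[/Rp -> cq] bE; apply: IHq.
Qed.

(** Edges inside a branch set are contracted, and one edge is kept between any two of them. As
    branch sets are connected, a cut that avoids [C] has a side constant on each, so on the kept
    edges it is a cut of K4. *)
Lemma k4_model_minor (T V : finType) (s t : T -> V) (M : matroid T) :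
  rowcoded (cut s t) M -> k4_model (adj s t setT) ->
  has_minor M (cycle_matroid (complete_graph 4)).
Proof.
move=> WM [beta [H1 H2]].
have /fin_all_exists[iota iotaE] (k : edge (complete_graph 4)) : exists e : T,
    beta (s e) = Some (ends k).1 /\ beta (t e) = Some (ends k).2 \/
    beta (s e) = Some (ends k).2 /\ beta (t e) = Some (ends k).1.
  have [|a [b [ai bj /adjP[_ [e _ He]]]]] := H1 (ends k).1 (ends k).2.
    by apply: contraTneq (valP k) => /= ->; rewrite ltnn.
  by exists e; case: He => -[-> ->]; [left|right].
have /fin_all_exists[alpha alphaE] (i : 'I_4) : exists a, beta a = Some i.
  (* [H1] speaks of pairs, so some index different from [i] has to be supplied. *)
  have [|a [b [ai _ _]]] := H1 i (if i == ord0 then ord_max else ord0).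
    by case: (eqVneq i ord0) => [->|].
  by exists a.
have iota_inj : injective iota.
  move=> k l E; apply: (@k4_joins_inj _ Some); first by move=> i j [].
  have := iotaE k; rewrite E; case: (iotaE l) => -[-> ->] [] [-> ->]; by [left|right].
pose C := [set e | (beta (s e) == beta (t e)) && (beta (s e) != None)].
have iotaC k : iota k \notin C.
  rewrite inE negb_and; apply/orP; left; apply: contraTneq (valP k) => E.
  rewrite -leqNgt; case: (iotaE k) => -[E1 E2]; move: E; rewrite E1 E2 => -[] /= -> //.
pose D := [set e : {e | e \notin C} | val e \notin codom iota].
exists C, D.
have /fin_all_exists[f fE] (u : {e | e \notin D}) : exists k, val (val u) = iota k.
  by have := valP u; rewrite inE negbK => /codomP.
have /fin_all_exists[g gE] k : exists u : {e | e \notin D}, val (val u) = iota k.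
  have kD : (Sub (iota k) (iotaC k) : {e | e \notin C}) \notin D.
    by rewrite inE negbK /= codom_f.
  by exists (Sub (Sub (iota k) (iotaC k)) kD).
have fK : cancel f g by move=> u; do 2!apply: val_inj; rewrite gE fE.
have gK : cancel g f by move=> k; apply: iota_inj; rewrite -fE gE.
apply: (iso_rowcoded fK gK (is_code_cut (fun k => (ends k).1) (fun k => (ends k).2)));
  last exact: rowcoded_cycle_matroid.
have /eq_rowcoded :=
  rowcoded_delete (D := D) (rowcoded_contract (C := C) (is_code_cut s t) WM).
apply=> w; split.
  move=> [w1 [w2 [[p w2p] w2C] w1E] wE].
  have pE a b : beta a = beta b -> beta a != None -> p a = p b.
    (* The relation in [H2] also has steps between vertices outside the branch sets, whose edges are
       not in [C]; [p'] is made constant there. *)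
    move=> ab na; pose p' c := if beta c is Some _ then p c else false.
    have : p' a = p' b; last by rewrite /p' -ab; case: (beta a) na.
    apply: connect_const (H2 a b ab na) => c d /andP[/adjP[_ [e _ He]] /eqP cd].
    rewrite /p' -cd; case Ec: (beta c) => [i|//].
    have /w2C : e \in C by rewrite inE; case: He => -[-> ->]; rewrite -?cd Ec eqxx.
    rewrite w2p /delta; case: He => -[-> ->]; by case: (p c) (p d) => [] [].
  have pa a i : beta a = Some i -> p a = p (alpha i).
    by move=> ai; apply: pE; rewrite ?alphaE ai.
  exists (p \o alpha) => k; rewrite /= wE /= w1E /= gE w2p /delta /=.
  by case: (iotaE k) => -[/pa-> /pa->] //; rewrite addbC.
move=> [q wq].
pose p a := if beta a is Some i then q i else false.
exists (delta s t p \o val); last first.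
  move=> u; rewrite -[u in LHS]fK -[LHS]/((w \o g) (f u)) wq /= fE /delta /p.
  by case: (iotaE (f u)) => -[-> ->] //; rewrite addbC.
exists (delta s t p) => //; split; first by exists p.
by move=> e; rewrite inE /delta /p => /andP[/eqP-> _]; rewrite addbb.
Qed.

(** * The two implications *)

Lemma dual_split_graphic (T : finType) (M : matroid T) (hM : graphic M) x y :
  ~ has_minor M (cycle_matroid (complete_graph 4)) -> x != y ->
  cographic (elem_split (graphic_binary hM) x y).
Proof.
move=> nk4 xy; have [V [s [t [sM wM]]]] := graphic_codes hM.
have nmodel : ~ k4_model (adj s t setT) by apply: contra_not nk4; apply: k4_model_minor.
have [U [u [v [uxy H]]]] := no_k4_dual_touching x y nmodel.
have Hz z : even s t z <-> cut u v z.
  by apply: iff_trans (H z); split=> [|[]//]; split.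
pose u' (e : option T) := if e is Some e then u e else v x.
pose v' (e : option T) := if e is Some e then v e else v y.
apply: (@rowcoded_graphic _ _ u' v').
have cM := coded_elem_split (graphic_binary hM) sM xy.
apply: eq_rowcoded (rowcoded_dual (is_code_split x y (is_code_even s t)) cM).
move=> w; split=> [[/Hz[p wp] wN]|[p wp]].
  exists p => -[e|]; first exact: wp.
  rewrite wN -[w (Some x)]/((w \o Some) x) -[w (Some y)]/((w \o Some) y) !wp.
  by rewrite /delta /= uxy; case: (p _) (p _) (p _) => [] [] [].
split; first by apply/Hz; exists p => e; rewrite /= wp.
by rewrite !wp /delta /= uxy; case: (p _) (p _) (p _) => [] [] [].
Qed.

Lemma sum_eq_addb (V : finType) (a b : V) : a != b ->
  \sum_c ((a == c) (+) (b == c)) = 2.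
Proof.
move=> ab; have ba : (b == a) = false by rewrite eq_sym (negbTE ab).
rewrite (bigD1 a) //= (bigD1 b) ?ba //= !eqxx ?ba (negbTE ab) big1 // => c /andP[ca cb].
by rewrite ![_ == c]eq_sym (negbTE ca) (negbTE cb).
Qed.

(** The minor is formed on words and not inside the splitting: the even sets of [M] that vanish on
    [D], read at the [iota k], are the even sets of K4. In a graph for the dual of the splitting,
    vanishing on [D] means contracting [D], while the values on [C] are ignored. *)
Lemma k4_minor_not_cographic (T : finType) (M : matroid T) (hM : graphic M) :
  has_minor M (cycle_matroid (complete_graph 4)) ->
  exists x y, x != y /\ ~ cographic (elem_split (graphic_binary hM) x y).
Proof.
move=> [C [D [f [g fK gK] iso]]]; have [V0 [s [t [sM _]]]] := graphic_codes hM.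
have cZ := is_code_even s t.
pose K4 := complete_graph 4.
pose evenK := even (fun k : edge K4 => (ends k).1) (fun k : edge K4 => (ends k).2).
have cK : is_code evenK := is_code_even _ _.
pose iota k := val (val (g k)).
have iota_inj : injective iota by move=> k l /val_inj/val_inj/(can_inj gK).
have EN : forall z, _ <-> evenK (z \o g) :=
  coded_uniq (is_code_shorten D (is_code_restrict C cZ)) (is_code_comp g cK)
    (coded_delete (is_code_restrict C cZ) (coded_contract cZ sM))
    (coded_iso fK gK cK iso (@coded_cycle_matroid K4)).
have toK z : even s t z -> {in D, forall d, z (val d) = false} -> evenK (z \o iota).
  move=> zz zD; apply: (code_ext cK (z := (z \o val \o val) \o g)) => //.
  by apply/EN; exists (z \o val) => //; split=> //; exists z.
have fromK zK : evenK zK -> exists z, [/\ even s t z, {in D, forall d, z (val d) = false} &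
    forall k, z (iota k) = zK k].
  move=> zzK; have /EN : evenK ((zK \o f) \o g).
    by apply: (code_ext cK _ zzK) => k /=; rewrite gK.
  move=> [z1 [[z zz z1E] z1D] E]; exists z; split=> // [d dD|k].
    by rewrite -[LHS]z1E z1D.
  by have := E (g k); rewrite /= gK z1E /= => ->.
have xy : iota k01 != iota k23 by rewrite (inj_eq iota_inj).
exists (iota k01), (iota k23); split=> // /graphic_codes[V [u [v [_ wM]]]].
have cM := coded_elem_split (graphic_binary hM) sM xy.
have cS := is_code_split (iota k01) (iota k23) cZ.
have EW := rowcoded_uniq cS (is_code_cut u v) (rowcoded_dual cS cM) wM.
(* The classes of R are the vertices of (V, u, v) after contracting D. *)
pose R : rel V := [rel a b | [exists d in D,
  ((u (Some (val d)) == a) && (v (Some (val d)) == b)) ||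
  ((u (Some (val d)) == b) && (v (Some (val d)) == a))]].
have RC : connect_sym R.
  apply: sym_connect_sym => a b.
  by apply: eq_existsb => d; rewrite orbC.
have Rcut p : {in D, forall d, delta u v p (Some (val d)) = false} ->
    forall a b, connect R a b -> p a = p b.
  move=> pD a b; apply: connect_const => c d /exists_inP[e eD He].
  have := pD e eD; rewrite /delta.
  by case/orP: He => /andP[/eqP-> /eqP->]; case: (p c) (p d) => [] [].
pose p c a := fingraph.root R a == c.
have pD c : {in D, forall d, delta u v (p c) (Some (val d)) = false}.
  move=> d dD; rewrite /delta /p.
  have -> : fingraph.root R (u (Some (val d))) = fingraph.root R (v (Some (val d))).
    apply/eqP; rewrite root_connect //; apply: connect1; apply/exists_inP.
    by exists d; rewrite ?eqxx.
  exact: addbb.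
(* The word of [z] is a cut vanishing on [D], so its side is constant on classes, and an element
   where it is nonzero joins two different classes. *)
have sep e z : even s t z -> {in D, forall d, z (val d) = false} ->
    (if e is Some e then z e else z (iota k01) (+) z (iota k23)) ->
    fingraph.root R (u e) != fingraph.root R (v e).
  move=> zz zD ze; pose w e := if e is Some e then z e else z (iota k01) (+) z (iota k23).
  have /EW[q wq] : split_code (even s t) (iota k01) (iota k23) w by split.
  rewrite root_connect //; apply/negP => /(Rcut q) E.
  have : w e by [].
  rewrite wq /delta E ?addbb // => d dD.
  by rewrite -wq; apply: zD.
have sepK k : fingraph.root R (u (Some (iota k))) != fingraph.root R (v (Some (iota k))).
  have [i ik] := triangle_through k.
  have [z [zz zD zE]] := fromK _ (even_triangle i).
  by apply: (sep _ z) => //; rewrite zE.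
have sepN : fingraph.root R (u None) != fingraph.root R (v None).
  have [z [zz zD zE]] := fromK _ (even_triangle ord0).
  by apply: (sep _ z) => //; rewrite !zE triangle_diagonal.
(* The star of a class vanishes on [D]; at the [iota k] it is an even set of K4, and the splitting
   forces its value at [None]. *)
have div4 c : 4 %| \sum_k delta u v (p c) (Some (iota k)) + delta u v (p c) None.
  have /EW[zz ->] : cut u v (delta u v (p c)) by exists (p c).
  exact: (k4_even_weight (toK _ zz (pD c))).
(* If F7 were graphic, its vertex stars, whose sizes are 0 or 4, would add up to
   twice the number of edges, that is 14. *)
have : 4 %| \sum_c (\sum_k delta u v (p c) (Some (iota k)) + delta u v (p c) None).
  by apply: dvdn_sum.
rewrite big_split exchange_big /= sum_eq_addb //.
under eq_bigr do rewrite sum_eq_addb //.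
by rewrite big_k4.
Qed.

Theorem theorem1p6 (T : finType) (M : matroid T) (hM : graphic M) :
  (forall x y : T, x != y ->
     cographic (elem_split (graphic_binary hM) x y)) <->
  ~ has_minor M (cycle_matroid (complete_graph 4)).
Proof.
split=> [H /(k4_minor_not_cographic hM)[x [y [xy]]]|nk4 x y].
  by apply; apply: H.
exact: dual_split_graphic.
Qed.
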